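(* (1) For every first-order sentence $\phi$: $\mathsf{LT}_{\mathrm{fo}}^{+}\vdash\phi$ if and only if $\mathsf{LT}_{\mathrm{b}}^{+}\vdash\phi$. (2) For every second-order sentence $\phi$: $\mathsf{LT}_{\mathrm{b}}^{+}\vdash\phi$ if and only if $\mathsf{LT}_{\mathrm{fo}}^{+}\vdash\phi^{\dagger}$. Moreover, $\mathsf{LT}_{\mathrm{b}}^{+}$ proves that the translation $\dagger$ is the identity on first-order entities and an isomorphism over second-order entities (sending each $n$-ary $F$ to $\{\langle x_1,\dots,x_n\rangle : F(\vec x)\}$).
   Context: Level notions: $\mathrm{pot}(a)=\{x:\exists c(x\subseteq c\wedge c\in a)\}$; a history is $h$ with $x=\mathrm{pot}(x\cap h)$ for all $x\in h$; a level is $\mathrm{pot}(h)$ for a history $h$. Endless: every level $s$ has a level $t$ with $s\in t$. $\mathsf{LT}_{\mathrm{fo}}^{+}$ is the first-order theory with Extensionality, the Separation schema, Stratification (every set is a subset of some level), and Endless. For $n$-ary second-order $F$ and a set $s$, write $F\sqsubseteq s$ for $\forall\vec x(F(\vec x)\to(x_1\subseteq s\wedge\dots\wedge x_n\subseteq s))$. $\mathsf{LT}_{\mathrm{b}}$ is the second-order theory whose axioms are Extensionality, Separation ($\forall F\forall a\exists b\forall x(x\in b\leftrightarrow(F(x)\wedge x\in a))$), Stratification, Strat$_b$: $\forall F\exists s(s\text{ a level}\wedge F\sqsubseteq s)$, and the scheme Comp$_b$: for every level $s$ there is $F\sqsubseteq s$ with $\forall\vec x((x_1\subseteq s\wedge\dots\wedge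 x_n\subseteq s)\to(F(\vec x)\leftrightarrow\phi))$, for $\phi$ not containing $F$; Comp$_b$ replaces the usual second-order Comprehension scheme. $\mathsf{LT}_{\mathrm{b}}^{+}$ is $\mathsf{LT}_{\mathrm{b}}$ plus Endless. The translation $\dagger$ treats each $n$-ary second-order variable $Y^n$ as a new first-order variable, with $(Y^n(x_1,\dots,x_n))^\dagger:=\langle x_1,\dots,x_n\rangle\in Y^n$ and $(\forall Y^n\phi)^\dagger:=\forall Y^n(\forall z\in Y^n(z\text{ is an }n\text{-tuple})\to\phi^\dagger)$, commuting with the other connectives and first-order quantifiers; $n$-tuples are Wiener–Kuratowski tuples. *)

(* Defs.v *)
From mathcomp Require Import all_boot.
From Stdlib Require List.

Set Implicit Arguments.
Unset Strict Implicit.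
Unset Printing Implicit Defensive.

(* First-order variables are de Bruijn indices counting first-order binders   *)
(* only.  Second-order variables are indexed by their arity code n (arity    *)
(* n.+1, so every second-order variable has arity >= 1) and a de Bruijn index *)
(* counting only the second-order binders of the same arity code.             *)
(*   FApp Y x xs  ==  Y(x, xs...)  where Y has arity (size xs).+1             *)
(*   FAllS n p    ==  forall Y^(n.+1), p                                      *)
Inductive form : Type :=
| FBot
| FEq (x y : nat)
| FIn (x y : nat)
| FApp (Y x : nat) (xs : seq nat)
| FImp (p q : form)
| FAllF (p : form)
| FAllS (n : nat) (p : form).

Definition FNot p := FImp p FBot.
Definition FTop := FImp FBot FBot.
Definition FAnd p q := FNot (FImp p (FNot q)).
Definition FOr p q := FImp (FNot p) q.
Definition FIff p q := FAnd (FImp p q) (FImp q p).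
Definition FEx p := FNot (FAllF (FNot p)).
Definition FExS n p := FNot (FAllS n (FNot p)).
Definition BigAnd (ps : seq form) := foldr FAnd FTop ps.
Definition AllFn (k : nat) (p : form) := iter k FAllF p.
Definition ExFn (k : nat) (p : form) := iter k FEx p.

Fixpoint isFO (p : form) : bool :=
  match p with
  | FApp _ _ _ | FAllS _ _ => false
  | FImp p q => isFO p && isFO q
  | FAllF p => isFO p
  | _ => true
  end.

Fixpoint fo_bnd (k : nat) (p : form) {struct p} : bool :=
  match p with
  | FBot => true
  | FEq x y | FIn x y => (x < k) && (y < k)
  | FApp _ x xs => all (fun v => v < k) (x :: xs)
  | FImp p q => fo_bnd k p && fo_bnd k q
  | FAllF p => fo_bnd k.+1 p
  | FAllS _ p => fo_bnd k p
  end.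

Fixpoint so_bnd (b : nat -> nat) (p : form) {struct p} : bool :=
  match p with
  | FApp Y _ xs => Y < b (size xs)
  | FImp p q => so_bnd b p && so_bnd b q
  | FAllF p => so_bnd b p
  | FAllS n p => so_bnd (fun m => if m == n then (b m).+1 else b m) p
  | _ => true
  end.

Definition sentence (p : form) : bool := fo_bnd 0 p && so_bnd (fun _ => 0) p.

Definition up (f : nat -> nat) : nat -> nat :=
  fun i => if i is j.+1 then (f j).+1 else 0.
Definition inst (t : nat) : nat -> nat :=
  fun i => if i is j.+1 then j else t.

Fixpoint ren_fo (f : nat -> nat) (p : form) {struct p} : form :=
  match p with
  | FBot => FBot
  | FEq x y => FEq (f x) (f y)
  | FIn x y => FIn (f x) (f y)
  | FApp Y x xs => FApp Y (f x) (map f xs)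
  | FImp p q => FImp (ren_fo f p) (ren_fo f q)
  | FAllF p => FAllF (ren_fo (up f) p)
  | FAllS n p => FAllS n (ren_fo f p)
  end.

Fixpoint ren_so (n : nat) (f : nat -> nat) (p : form) {struct p} : form :=
  match p with
  | FApp Y x xs => if size xs == n then FApp (f Y) x xs else FApp Y x xs
  | FImp p q => FImp (ren_so n f p) (ren_so n f q)
  | FAllF p => FAllF (ren_so n f p)
  | FAllS m p => FAllS m (ren_so n (if m == n then up f else f) p)
  | p => p
  end.

(* Deduction: classical natural deduction for two-sorted logic with identity *)
(* (second-order quantifiers instantiated by variables only: no built-in     *)
(* comprehension; comprehension is given by the axioms of the theory).       *)
Inductive nd : seq form -> form -> Prop :=
| nd_ax G p : List.In p G -> nd G p
| nd_impI G p q : nd (p :: G) q -> nd G (FImp p q)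
| nd_impE G p q : nd G (FImp p q) -> nd G p -> nd G q
| nd_raa G p : nd (FNot p :: G) FBot -> nd G p
| nd_allFI G p : nd (map (ren_fo S) G) p -> nd G (FAllF p)
| nd_allFE G p t : nd G (FAllF p) -> nd G (ren_fo (inst t) p)
| nd_allSI G n p : nd (map (ren_so n S) G) p -> nd G (FAllS n p)
| nd_allSE G n p Y : nd G (FAllS n p) -> nd G (ren_so n (inst Y) p)
| nd_refl G x : nd G (FEq x x)
| nd_subst G x y p :
    nd G (FEq x y) -> nd G (ren_fo (inst x) p) -> nd G (ren_fo (inst y) p).

Definition proves (T : form -> Prop) (p : form) : Prop :=
  exists G : seq form, (forall q, List.In q G -> T q) /\ nd G p.

Definition Subset (x y : nat) : form := FAllF (FImp (FIn 0 x.+1) (FIn 0 y.+1)).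
Definition InPotCap (y x h : nat) : form :=
  FEx (FAnd (Subset y.+1 0) (FAnd (FIn 0 x.+1) (FIn 0 h.+1))).
Definition InPot (y a : nat) : form := FEx (FAnd (Subset y.+1 0) (FIn 0 a.+1)).
Definition History (h : nat) : form :=
  FAllF (FImp (FIn 0 h.+1) (FAllF (FIff (FIn 0 1) (InPotCap 0 1 h.+2)))).
Definition Level (s : nat) : form :=
  FEx (FAnd (History 0) (FAllF (FIff (FIn 0 s.+2) (InPot 0 1)))).

(* Kuratowski pairs and (right-nested) tuples  <x1,...,xk> = <x1,<x2,...,xk>>,
   <x> = x. *)
Definition Sing (w a : nat) : form := FAllF (FIff (FIn 0 w.+1) (FEq 0 a.+1)).
Definition Doub (w a b : nat) : form :=
  FAllF (FIff (FIn 0 w.+1) (FOr (FEq 0 a.+1) (FEq 0 b.+1))).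
Definition IsPair (z a b : nat) : form :=
  FAllF (FIff (FIn 0 z.+1) (FOr (Sing 0 a.+1) (Doub 0 a.+1 b.+1))).
(* z = <x+k, xs+k...>  (the components are shifted by k, z is not) *)
Fixpoint TupEqK (k z x : nat) (xs : seq nat) {struct xs} : form :=
  match xs with
  | [::] => FEq z (x + k)
  | y :: ys => FEx (FAnd (TupEqK k.+1 0 y ys) (IsPair z.+1 (x + k).+1 0))
  end.
Definition TupEq (z x : nat) (xs : seq nat) : form := TupEqK 0 z x xs.
Definition IsTupN (n z : nat) : form :=
  ExFn n.+1 (TupEq (z + n.+1) n (rev (iota 0 n))).

(* F ⊑ s, for F of arity code n: ∀x1..x_{n+1}(F(x⃗) → ∧_i x_i ⊆ s);
   inside the binders x1 has index n, ..., x_{n+1} has index 0. *)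
Definition SubRel (n F s : nat) : form :=
  AllFn n.+1 (FImp (FApp F n (rev (iota 0 n)))
                   (BigAnd [seq Subset i (s + n.+1) | i <- iota 0 n.+1])).

Definition Extensionality : form :=
  FAllF (FAllF (FImp (FAllF (FIff (FIn 0 2) (FIn 0 1))) (FEq 1 0))).
Definition Stratification : form :=
  FAllF (FEx (FAnd (Level 0) (Subset 1 0))).
Definition Endless : form :=
  FAllF (FImp (Level 0) (FEx (FAnd (Level 0) (FIn 1 0)))).

(* first-order Separation instance: ∀a∃b∀x(x∈b ↔ (φ ∧ x∈a));
   in φ: index 0 = x, 1 = a, i >= 2 = parameter i-2 (b does not occur). *)
Definition SepFOInst (phi : form) : form :=
  FAllF (FEx (FAllF (FIff (FIn 0 1)
     (FAnd (ren_fo (fun i => match i with 0 => 0 | 1 => 2 | j => j.+1 end) phi)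
           (FIn 0 2))))).

Definition SepSO : form :=
  FAllS 0 (FAllF (FEx (FAllF (FIff (FIn 0 1) (FAnd (FApp 0 0 [::]) (FIn 0 2)))))).

Definition StratB (n : nat) : form :=
  FAllS n (FEx (FAnd (Level 0) (SubRel n 0 0))).

(* Comp_b instance for arity n.+1:
   ∀s (s a level → ∃F (F ⊑ s ∧ ∀x1..x_{n+1} (∧ x_i ⊆ s → (F(x⃗) ↔ φ)))).
   In φ: first-order index i <= n is x_{n+1-i}, n.+1 is s, larger indices are
   parameters; all second-order variables of φ are parameters (F is lifted
   away, so φ does not contain F). *)
Definition CompBInst (n : nat) (phi : form) : form :=
  FAllF (FImp (Level 0)
   (FExS n (FAnd (SubRel n 0 0)
     (AllFn n.+1 (FImp (BigAnd [seq Subset i n.+1 | i <- iota 0 n.+1])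
                       (FIff (FApp 0 n (rev (iota 0 n))) (ren_so n S phi))))))).

Definition close (pre : seq (option nat)) (p : form) : form :=
  foldr (fun k q => match k with None => FAllF q | Some n => FAllS n q end) p pre.

Inductive LTfo_plus : form -> Prop :=
| LTfo_ext : LTfo_plus Extensionality
| LTfo_strat : LTfo_plus Stratification
| LTfo_endless : LTfo_plus Endless
| LTfo_sep (k : nat) (phi : form) :
    isFO phi -> sentence (AllFn k (SepFOInst phi)) ->
    LTfo_plus (AllFn k (SepFOInst phi)).

Inductive LTb_plus : form -> Prop :=
| LTb_ext : LTb_plus Extensionality
| LTb_sep : LTb_plus SepSO
| LTb_strat : LTb_plus Stratification
| LTb_stratb (n : nat) : LTb_plus (StratB n)
| LTb_comp (n : nat) (pre : seq (option nat)) (phi : form) :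
    sentence (close pre (CompBInst n phi)) ->
    LTb_plus (close pre (CompBInst n phi))
| LTb_endless : LTb_plus Endless.

(* The translation †.  The context c lists the binders passed (innermost     *)
(* first): None = first-order, Some n = second-order of arity code n.  In    *)
(* the output every binder becomes a first-order binder, so a variable is    *)
(* sent to the position of its binder in c.                                  *)
Fixpoint posF (c : seq (option nat)) (i : nat) : nat :=
  match c with
  | [::] => i
  | None :: c' => if i is j.+1 then (posF c' j).+1 else 0
  | Some _ :: c' => (posF c' i).+1
  end.

Fixpoint posS (c : seq (option nat)) (n i : nat) : nat :=
  match c with
  | [::] => i
  | None :: c' => (posS c' n i).+1
  | Some m :: c' =>
      if m == n then (if i is j.+1 then (posS c' n j).+1 else 0)
      else (posS c' n i).+1
  end.

Fixpoint dag (c : seq (option nat)) (p : form) {struct p} : form :=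
  match p with
  | FBot => FBot
  | FEq x y => FEq (posF c x) (posF c y)
  | FIn x y => FIn (posF c x) (posF c y)
  | FApp Y x xs =>
      FEx (FAnd (TupEq 0 (posF c x).+1 [seq (posF c v).+1 | v <- xs])
                (FIn 0 (posS c (size xs) Y).+1))
  | FImp p q => FImp (dag c p) (dag c q)
  | FAllF p => FAllF (dag (None :: c) p)
  | FAllS n p =>
      FAllF (FImp (FAllF (FImp (FIn 0 1) (IsTupN n 0))) (dag (Some n :: c) p))
  end.

Definition dagger (p : form) : form := dag [::] p.

Definition TupSet (n y : nat) : form := FAllF (FImp (FIn 0 y.+1) (IsTupN n 0)).

Definition Codes (n F y : nat) : form :=
  AllFn n.+1 (FIff (FApp F n (rev (iota 0 n)))
                   (FEx (FAnd (TupEq 0 n.+1 (map S (rev (iota 0 n))))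
                              (FIn 0 (y + n.+2))))).

Definition IsoTotal (n : nat) : form :=
  FAllS n (FEx (FAnd (TupSet n 0) (FAnd (Codes n 0 0)
     (FAllF (FImp (FAnd (TupSet n 0) (Codes n 0 0)) (FEq 0 1)))))).

Definition IsoOnto (n : nat) : form :=
  FAllF (FImp (TupSet n 0) (FExS n (Codes n 0 0))).

(* Main.v *)
(* Deductions are replaced by models: soundness and a Henkin completeness theorem
   for the two-sorted calculus reduce everything to semantics.  In a model of
   LTb+, bounded comprehension first yields separation below a level, which is
   enough to show that levels are well-founded, hence transitive; full first-order
   separation follows, so the sets form a model of LTfo+.  There the levels are
   linearly ordered by membership, so Kuratowski tuples exist and are injective,
   and every relation, being bounded by a level, is coded by a unique set of
   tuples.  Conversely, in a model of LTfo+ the sets of n-tuples, taken as n-ary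
   relations, give a model of LTb+: comprehension for a formula is separation for
   its translation.  In both cases the coding makes a formula and its translation
   equivalent, and the translation fixes first-order sentences. *)
Require Import Defs.
From mathcomp Require Import all_boot.
From Stdlib Require Import Classical ClassicalEpsilon FunctionalExtensionality.
From Stdlib Require Import PropExtensionality Setoid.

Set Implicit Arguments.
Unset Strict Implicit.
Unset Printing Implicit Defensive.

(** * Renaming and Henkin semantics *)

(** Both theories meet in the record [isLT], where Separation is stated for predicates definable by
    first-order formulas with parameters. The delicate direction starts from bounded comprehension:
    it realises a predicate only on the subsets of a level [s], whereas separating from [a] needs it
    on the members of [a]. Members of a level are known to be subsets of it only once levels are
    transitive, so the well-foundedness argument has to live with the bound. Endless enters through
    tuples: each further component raises a tuple by two levels, and the tuples over a level must
    fit into a single later level before a code can be separated from it. The calculus has no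
    comprehension rule, so models with an arbitrary domain of relations match it exactly. Since the
    axioms are sentences, every variable remains available as a Henkin witness. *)

Definition scons (A : Type) (d : A) (r : nat -> A) : nat -> A :=
  fun i => if i is j.+1 then r j else d.
Definition sconsS (A : Type) (n : nat) (u : A) (s : nat -> nat -> A) :
  nat -> nat -> A := fun m => if m == n then scons u (s m) else s m.
Definition upS (n : nat) (g : nat -> nat -> nat) : nat -> nat -> nat :=
  fun m => if m == n then up (g m) else g m.
Definition idS (n : nat) : nat -> nat := id.
Definition single (n : nat) (h : nat -> nat) : nat -> nat -> nat :=
  fun m => if m == n then h else id.

(** Renaming both sorts at once covers [ren_fo] and [ren_so] as special cases, so composition,
    bounds and satisfaction take one induction each. *)
Fixpoint ren (f : nat -> nat) (g : nat -> nat -> nat) (p : form) : form :=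
  match p with
  | FBot => FBot
  | FEq x y => FEq (f x) (f y)
  | FIn x y => FIn (f x) (f y)
  | FApp Y x xs => FApp (g (size xs) Y) (f x) (map f xs)
  | FImp p q => FImp (ren f g p) (ren f g q)
  | FAllF p => FAllF (ren (up f) g p)
  | FAllS n p => FAllS n (ren f (upS n g) p)
  end.

Lemma up_id : up id = id.
Proof. by apply: functional_extensionality => -[]. Qed.

Lemma up_comp f h : up f \o up h = up (f \o h).
Proof. by apply: functional_extensionality => -[]. Qed.

Lemma upS_id n : upS n idS = idS.
Proof.
by apply: functional_extensionality => m; rewrite /upS; case: eqP => // _; exact: up_id.
Qed.

Lemma upS_comp n g k :
  (fun m => upS n g m \o upS n k m) = upS n (fun m => g m \o k m).
Proof.
by apply: functional_extensionality => m; rewrite /upS; case: eqP; rewrite ?up_comp.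
Qed.

Lemma upS_single n m h :
  upS m (single n h) = single n (if m == n then up h else h).
Proof.
apply: functional_extensionality => k; rewrite /upS /single.
case: (eqVneq k m) => [->|km]; first by case: (m == n); rewrite ?up_id.
by case: (eqVneq k n) => // <-; rewrite eq_sym (negbTE km).
Qed.

Lemma ren_foE f p : ren_fo f p = ren f idS p.
Proof.
elim: p f => //= [p IHp q IHq|p IH|n p IH] f; rewrite ?upS_id ?IH ?IHp ?IHq //.
Qed.

Lemma ren_soE n h p : ren_so n h p = ren id (single n h) p.
Proof.
elim: p h => //= [Y x xs|p IHp q IHq|p IH|m p IH] h.
- by rewrite /single map_id; case: ifP.
- by rewrite IHp IHq.
- by rewrite up_id IH.
- by rewrite upS_single IH.
Qed.

Lemma ren_ren f g h k p :
  ren f g (ren h k p) = ren (f \o h) (fun m => g m \o k m) p.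
Proof.
elim: p f g h k => //= [Y x xs|p IHp q IHq|p IH|n p IH] f g h k.
- by rewrite -map_comp size_map.
- by rewrite IHp IHq.
- by rewrite IH up_comp.
- by rewrite IH upS_comp.
Qed.

Lemma isFO_ren f g p : isFO (ren f g p) = isFO p.
Proof. by elim: p f g => //= p IHp q IHq f g; rewrite IHp IHq. Qed.

(** * Variable bounds and renaming *)

Lemma ren_bnd f g f' g' k b p : fo_bnd k p -> so_bnd b p ->
  (forall i, i < k -> f i = f' i) ->
  (forall n i, i < b n -> g n i = g' n i) -> ren f g p = ren f' g' p.
Proof.
elim: p f g f' g' k b => //=
  [x y|x y|Y x xs|p IHp q IHq|p IH|n p IH] f g f' g' k b.
- by move=> /andP[xk yk] _ ff' _; rewrite !ff'.
- by move=> /andP[xk yk] _ ff' _; rewrite !ff'.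
- move=> /andP[xk /allP xsk] Yb ff' gg'; rewrite gg' // ff' //; congr FApp.
  by apply/eq_in_map => v /xsk /ff'.
- by move=> /andP[? ?] /andP[? ?] ff' gg'; rewrite (IHp f g f' g' k b) // (IHq f g f' g' k b).
- move=> pk pb ff' gg'; congr FAllF; apply: IH pk pb _ gg' => -[|i] //= ik.
  by rewrite ff'.
- move=> pk pb ff' gg'; congr FAllS; apply: IH pk pb ff' _ => m i.
  rewrite /upS; case: eqP => [->|_]; last exact: gg'.
  by case: i => //= i ib; rewrite gg'.
Qed.

Lemma ren_id p : ren id idS p = p.
Proof.
elim: p => //= [Y x xs|p -> q ->|p IH|n p IH] //.
- by rewrite map_id.
- by rewrite up_id IH.
- by rewrite upS_id IH.
Qed.

Lemma ren_sentence f g p : sentence p -> ren f g p = p.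
Proof. by move=> /andP[pk pb]; rewrite -[RHS]ren_id; apply: ren_bnd pk pb _ _. Qed.

Lemma fo_bnd_ren f g k k' p : (forall i, i < k -> f i < k') ->
  fo_bnd k p -> fo_bnd k' (ren f g p).
Proof.
elim: p f g k k' => //= [x y|x y|Y x xs|p IHp q IHq|p IH|n p IH] f g k k' fk.
- by move=> /andP[xk yk]; rewrite !fk.
- by move=> /andP[xk yk]; rewrite !fk.
- move=> /andP[xk /allP xsk]; rewrite fk //=; apply/allP => v /mapP[w /xsk wk ->].
  exact: fk.
- by move=> /andP[pk qk]; rewrite (IHp f g k k') ?(IHq f g k k').
- by apply: IH => -[|i] //; apply: fk.
- exact: IH.
Qed.

Lemma so_bnd_ren f g b b' p : (forall n i, i < b n -> g n i < b' n) ->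
  so_bnd b p -> so_bnd b' (ren f g p).
Proof.
elim: p f g b b' => //= [Y x xs|p IHp q IHq|p IH|n p IH] f g b b' gb.
- by rewrite size_map; apply: gb.
- by move=> /andP[pk qk]; rewrite (IHp f g b b') ?(IHq f g b b').
- exact: IH.
- apply: IH => m i; rewrite /upS; case: eqP => [->|_]; last exact: gb.
  by case: i => //= i; apply: gb.
Qed.

Lemma fo_bnd_mono k k' p : k <= k' -> fo_bnd k p -> fo_bnd k' p.
Proof.
move=> kk' pk; rewrite -[p]ren_id; apply: fo_bnd_ren pk => i ik.
exact: leq_trans ik kk'.
Qed.

Lemma so_bnd_mono b b' p : (forall n, b n <= b' n) -> so_bnd b p -> so_bnd b' p.
Proof.
move=> bb' pb; rewrite -[p]ren_id; apply: so_bnd_ren pb => n i ib.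
exact: leq_trans ib (bb' n).
Qed.

Lemma so_bnd_FO b p : isFO p -> so_bnd b p.
Proof. by elim: p b => //= p IHp q IHq b /andP[/IHp-> /IHq->]. Qed.

(** Binders are not subtracted and all arities share one bound: an overestimate of the free
    variables of both sorts that needs no depth argument. *)
Fixpoint mxv (p : form) : nat :=
  match p with
  | FBot => 0
  | FEq x y | FIn x y => (maxn x y).+1
  | FApp Y x xs => (maxn Y (foldr maxn x xs)).+1
  | FImp p q => maxn (mxv p) (mxv q)
  | FAllF p | FAllS _ p => mxv p
  end.

Lemma fo_bnd_mxv p : fo_bnd (mxv p) p.
Proof.
elim: p => //= [x y|x y|Y x xs|p IHp q IHq|p IH].
- by rewrite !ltnS leq_maxl leq_maxr.
- by rewrite !ltnS leq_maxl leq_maxr.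
- have H v : (v == x) || (v \in xs) -> v < (maxn Y (foldr maxn x xs)).+1.
    rewrite ltnS => vx; apply: leq_trans (leq_maxr _ _).
    elim: xs vx => [|w xs IH] /=; first by rewrite orbF => /eqP->.
    rewrite inE orbCA => /orP[/eqP->|/IH vx]; first exact: leq_maxl.
    exact: leq_trans vx (leq_maxr _ _).
  by rewrite H ?eqxx //=; apply/allP => v vx; apply: H; rewrite vx orbT.
- rewrite (fo_bnd_mono _ IHp) ?leq_maxl //; exact: fo_bnd_mono (leq_maxr _ _) IHq.
- exact: fo_bnd_mono (leqnSn _) IH.
Qed.

Lemma so_bnd_mxv p : so_bnd (fun=> mxv p) p.
Proof.
elim: p => //= [Y x xs|p IHp q IHq|n p IH].
- by rewrite ltnS leq_maxl.
- by rewrite (so_bnd_mono _ IHp) ?(so_bnd_mono _ IHq) // => ?; rewrite ?leq_maxl ?leq_maxr.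
- by apply: so_bnd_mono IH => m; case: ifP.
Qed.

(** [rsort n u] admits [u] as a value for variables of arity code [n]. The language has no identity
    between relations, so distinct objects may share an extension, and one object may have several
    sorts. *)
Record model := Model {
  dom : Type;
  ein : dom -> dom -> Prop;
  robj : Type;
  rsort : nat -> robj -> Prop;
  rapp : robj -> seq dom -> Prop }.

Section Sat.
Variable M : model.
Implicit Types (r : nat -> dom M) (s : nat -> nat -> robj M) (p q : form).

Fixpoint sat r s p : Prop :=
  match p with
  | FBot => False
  | FEq x y => r x = r y
  | FIn x y => ein (r x) (r y)
  | FApp Y x xs => rapp (s (size xs) Y) (map r (x :: xs))
  | FImp p q => sat r s p -> sat r s q
  | FAllF p => forall d, sat (scons d r) s p
  | FAllS n p => forall u, rsort n u -> sat r (sconsS n u s) p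
  end.

Definition valid s := forall n i, rsort n (s n i).

Lemma scons_up d r f : scons d r \o up f = scons d (r \o f).
Proof. by apply: functional_extensionality => -[]. Qed.

Lemma sconsS_up n u s g :
  (fun m => sconsS n u s m \o upS n g m) = sconsS n u (fun m => s m \o g m).
Proof.
apply: functional_extensionality => m; rewrite /sconsS /upS; case: eqP => // _.
by apply: functional_extensionality => -[].
Qed.

Lemma sat_ren r s f g p :
  sat r s (ren f g p) <-> sat (r \o f) (fun n => s n \o g n) p.
Proof.
elim: p r s f g => //= [Y x xs|p IHp q IHq|p IH|n p IH] r s f g.
- by rewrite -map_comp size_map.
- by rewrite IHp IHq.
- by split=> H d; have := H d; rewrite IH scons_up.
- by split=> H u nu; have := H u nu; rewrite IH sconsS_up.
Qed.

Lemma sat_ren_fo r s f p : sat r s (ren_fo f p) <-> sat (r \o f) s p.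
Proof. by rewrite ren_foE sat_ren. Qed.

Lemma sat_inst r s t p : sat r s (ren_fo (inst t) p) <-> sat (scons (r t) r) s p.
Proof.
rewrite sat_ren_fo; suff -> : r \o inst t = scons (r t) r by [].
by apply: functional_extensionality => -[].
Qed.

Lemma sat_ren_so r s n f p : sat r s (ren_so n f p) <->
  sat r (fun m => if m == n then s m \o f else s m) p.
Proof.
rewrite ren_soE sat_ren.
suff -> : (fun m => s m \o single n f m) = (fun m => if m == n then s m \o f else s m) by [].
by apply: functional_extensionality => m; rewrite /single; case: eqP.
Qed.

Lemma sat_ren_soS r s n u p : sat r (sconsS n u s) (ren_so n S p) <-> sat r s p.
Proof.
rewrite sat_ren_so; suff -> : (fun m => if m == n then sconsS n u s m \o S
  else sconsS n u s m) = s by [].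
by apply: functional_extensionality => m; rewrite /sconsS; case: eqP.
Qed.

Lemma sat_instS r s n Y p :
  sat r s (ren_so n (inst Y) p) <-> sat r (sconsS n (s n Y) s) p.
Proof.
rewrite sat_ren_so; suff -> : (fun m => if m == n then s m \o inst Y else s m) =
  sconsS n (s n Y) s by [].
apply: functional_extensionality => m; rewrite /sconsS; case: eqP => // ->.
by apply: functional_extensionality => -[].
Qed.

Lemma valid_sconsS n u s : rsort n u -> valid s -> valid (sconsS n u s).
Proof.
move=> nu vs m i; rewrite /sconsS; case: eqP => [->|_]; last exact: vs.
by case: i => // i; exact: vs.
Qed.

Lemma sat_bnd k b r r' s s' p : fo_bnd k p -> so_bnd b p ->
  (forall i, i < k -> r i = r' i) ->
  (forall n i, i < b n -> s n i = s' n i) -> sat r s p -> sat r' s' p.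
Proof.
move=> pk pb rr ss; suff : sat r s p <-> sat r' s' p by case.
elim: p k b r r' s s' pk pb rr ss => //=
  [x y|x y|Y x xs|p IHp q IHq|p IH|n p IH] k b r r' s s'.
- by move=> /andP[xk yk] _ rr _; rewrite !rr.
- by move=> /andP[xk yk] _ rr _; rewrite !rr.
- move=> /andP[xk /allP xsk] Yb rr ss; rewrite ss // rr //.
  by have -> : map r xs = map r' xs by apply/eq_in_map => v /xsk /rr.
- move=> /andP[? ?] /andP[? ?] rr ss.
  by rewrite (IHp k b r r' s s') // (IHq k b r r' s s').
- move=> pk pb rr ss; suff H d : sat (scons d r) s p <-> sat (scons d r') s' p.
    by split=> Hd d; apply/H.
  by apply: IH pk pb _ ss => -[|i] //=; apply: rr.
- move=> pk pb rr ss.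
  suff H u : sat r (sconsS n u s) p <-> sat r' (sconsS n u s') p.
    by split=> Hu u nu; apply/H/Hu.
  apply: IH pk pb rr _ => m i; rewrite /sconsS.
  case: eqP => [->|_]; last exact: ss.
  by case: i => //= i; apply: ss.
Qed.

Lemma sat_sentence r r' s s' p : sentence p -> sat r s p -> sat r' s' p.
Proof. by move=> /andP[pk pb]; exact: (sat_bnd pk pb). Qed.

Lemma sat_not r s p : sat r s (FNot p) <-> ~ sat r s p.
Proof. by []. Qed.

Lemma sat_imp r s p q : sat r s (FImp p q) <-> (sat r s p -> sat r s q).
Proof. by []. Qed.

Lemma sat_allF r s p : sat r s (FAllF p) <-> forall d, sat (scons d r) s p.
Proof. by []. Qed.

Lemma sat_allS r s n p :
  sat r s (FAllS n p) <-> forall u, rsort n u -> sat r (sconsS n u s) p.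
Proof. by []. Qed.

Lemma sat_and r s p q : sat r s (FAnd p q) <-> sat r s p /\ sat r s q.
Proof. by rewrite /=; tauto. Qed.

Lemma sat_or r s p q : sat r s (FOr p q) <-> sat r s p \/ sat r s q.
Proof. by rewrite /=; tauto. Qed.

Lemma sat_iff r s p q : sat r s (FIff p q) <-> (sat r s p <-> sat r s q).
Proof. by rewrite /=; tauto. Qed.

Lemma sat_ex r s p : sat r s (FEx p) <-> exists d, sat (scons d r) s p.
Proof.
split=> [/= H|[d Hd] /= H]; last exact: H Hd.
by apply: NNPP => N; apply: H => d Hd; apply: N; exists d.
Qed.

Lemma sat_exS r s n p :
  sat r s (FExS n p) <-> exists u, rsort n u /\ sat r (sconsS n u s) p.
Proof.
split=> [/= H|[u [nu Hu]] /= H]; last exact: H nu Hu.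
by apply: NNPP => N; apply: H => u nu Hu; apply: N; exists u.
Qed.

Lemma soundness G p r s : nd G p -> valid s ->
  (forall q, List.In q G -> sat r s q) -> sat r s p.
Proof.
move=> D; elim: D r s => {G p}
  [G p pG|G p q _ IH|G p q _ IHpq _ IHp|G p _ IH|G p _ IH|G p t _ IH
  |G n p _ IH|G n p Y _ IH|//|G x y p _ IHxy _ IHp] r s vs HG.
- exact: HG.
- by move=> /= Hp; apply: IH => // q' [<-//|]; apply: HG.
- by apply: IHpq (HG) _ => //; apply: IHp.
- by apply: NNPP => N; apply: (IH r s vs) => // q [<-//|]; apply: HG.
- move=> d; apply: IH => // q /List.in_map_iff [q' [<- q'G]].
  by rewrite sat_ren_fo; apply: HG.
- by rewrite sat_inst; apply: (IH r s).
- move=> u nu; apply: IH => [|q /List.in_map_iff [q' [<- q'G]]].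
    exact: valid_sconsS.
  by rewrite sat_ren_soS; apply: HG.
- by rewrite sat_instS; apply: (IH r s).
- have /= xy := IHxy r s vs HG.
  by have := IHp r s vs HG; rewrite !sat_inst xy.
Qed.
End Sat.

Lemma proves_sat T p M (r : nat -> dom M) s : proves T p -> valid s ->
  (forall q, T q -> sat r s q) -> sat r s p.
Proof.
by move=> [G [GT D]] vs HT; apply: soundness D vs _ => q /GT; apply: HT.
Qed.

(** * Completeness *)

Lemma nd_weaken G G' p : nd G p -> (forall q, List.In q G -> List.In q G') -> nd G' p.
Proof.
move=> D; elim: D G' => {G p}
  [G p pG|G p q _ IH|G p q _ IHpq _ IHp|G p _ IH|G p _ IH|G p t _ IH
  |G n p _ IH|G n p Y _ IH|G x|G x y p _ IHxy _ IHp] G' GG'.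
- exact/nd_ax/GG'.
- by apply/nd_impI/IH => r [->|/GG']; [left|right].
- by apply: nd_impE (IHpq _ GG') (IHp _ GG').
- by apply/nd_raa/IH => r [->|/GG']; [left|right].
- apply/nd_allFI/IH => r /List.in_map_iff[r' [<- /GG' r'G]].
  exact: List.in_map.
- exact/nd_allFE/IH.
- apply/nd_allSI/IH => r /List.in_map_iff[r' [<- /GG' r'G]].
  exact: List.in_map.
- exact/nd_allSE/IH.
- exact: nd_refl.
- exact: nd_subst (IHxy _ GG') (IHp _ GG').
Qed.

Lemma ren_inst f g t p :
  ren f g (ren_fo (inst t) p) = ren_fo (inst (f t)) (ren (up f) g p).
Proof.
rewrite !ren_foE !ren_ren; congr ren.
by apply: functional_extensionality => -[].
Qed.

Lemma ren_shift f g p : ren (up f) g (ren_fo S p) = ren_fo S (ren f g p).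
Proof. by rewrite !ren_foE !ren_ren. Qed.

Lemma ren_instS f g n Y p :
  ren f g (ren_so n (inst Y) p) = ren_so n (inst (g n Y)) (ren f (upS n g) p).
Proof.
rewrite !ren_soE !ren_ren; congr ren.
apply: functional_extensionality => m; rewrite /single /upS.
by case: eqP => // ->; apply: functional_extensionality => -[].
Qed.

Lemma ren_shiftS f g n p :
  ren f (upS n g) (ren_so n S p) = ren_so n S (ren f g p).
Proof.
rewrite !ren_soE !ren_ren; congr ren.
by apply: functional_extensionality => m; rewrite /single /upS; case: eqP.
Qed.

(** [f] and [g] need not be injective: the generalisation rules shift all hypotheses, so their
    eigenvariable 0 cannot clash with a renamed variable. *)
Lemma nd_ren G p f g : nd G p -> nd (map (ren f g) G) (ren f g p).
Proof.
move=> D; elim: D f g => {G p}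
  [G p pG|G p q _ IH|G p q _ IHpq _ IHp|G p _ IH|G p _ IH|G p t _ IH
  |G n p _ IH|G n p Y _ IH|G x|G x y p _ IHxy _ IHp] f g.
- exact/nd_ax/List.in_map.
- exact/nd_impI/IH.
- exact: nd_impE (IHpq f g) (IHp f g).
- exact/nd_raa/IH.
- apply: nd_allFI; have := IH (up f) g; congr nd.
  by rewrite -!map_comp; apply: eq_map => q /=; rewrite ren_shift.
- by rewrite ren_inst; apply/nd_allFE/IH.
- apply: nd_allSI; have := IH f (upS n g); congr nd.
  by rewrite -!map_comp; apply: eq_map => q /=; rewrite ren_shiftS.
- by rewrite ren_instS; apply/nd_allSE/IH.
- exact: nd_refl.
- rewrite ren_inst; apply: nd_subst (IHxy f g) _.
  by rewrite -ren_inst; apply: IHp.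
Qed.

Lemma map_eq_in (A B : Type) (f g : A -> B) s :
  (forall x, List.In x s -> f x = g x) -> map f s = map g s.
Proof.
elim: s => //= x s IH H; rewrite H; last by left.
by rewrite IH // => y ys; apply: H; right.
Qed.

(** The renaming sends [t] to 0 and shifts everything else. On [G], which uses only indices below
    [t], it is the shift of [nd_allFI], and it turns the instance of [p] at [t] back into [p]. *)
Lemma nd_genF G p t : (forall q, List.In q G -> mxv q <= t) -> mxv p <= t ->
  nd G (ren_fo (inst t) p) -> nd G (FAllF p).
Proof.
move=> Gt pt /(nd_ren (fun i => if i == t then 0 else i.+1) idS) D.
apply: nd_allFI; move: D; congr nd.
  apply: map_eq_in => q /Gt qt; rewrite ren_foE.
  apply: ren_bnd (fo_bnd_mxv q) (so_bnd_mxv q) _ _ => // i iq.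
  by rewrite ltn_eqF // (leq_trans iq).
rewrite ren_foE ren_ren -[RHS]ren_id.
apply: ren_bnd (fo_bnd_mxv p) (so_bnd_mxv p) _ _ => //= -[_|i ip] /=.
  by rewrite eqxx.
by rewrite ltn_eqF // (leq_trans (ltnW ip)).
Qed.

Lemma nd_genS G n p t : (forall q, List.In q G -> mxv q <= t) -> mxv p <= t ->
  nd G (ren_so n (inst t) p) -> nd G (FAllS n p).
Proof.
move=> Gt pt /(nd_ren id (single n (fun i => if i == t then 0 else i.+1))) D.
apply: nd_allSI; move: D; congr nd.
  apply: map_eq_in => q /Gt qt; rewrite ren_soE.
  apply: ren_bnd (fo_bnd_mxv q) (so_bnd_mxv q) _ _ => // m i iq.
  by rewrite /single; case: eqP => // _; rewrite ltn_eqF // (leq_trans iq).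
rewrite ren_soE ren_ren -[RHS]ren_id.
apply: ren_bnd (fo_bnd_mxv p) (so_bnd_mxv p) _ _ => //= m i ip.
rewrite /single /idS; case: eqP => // _; case: i ip => [_|i ip] /=.
  by rewrite eqxx.
by rewrite ltn_eqF // (leq_trans (ltnW ip)).
Qed.

(** * Enumeration of all formulas *)

Import GenTree.

Fixpoint form_enc (p : form) : tree nat :=
  match p with
  | FBot => Node 0 [::]
  | FEq x y => Node 1 [:: Leaf x; Leaf y]
  | FIn x y => Node 2 [:: Leaf x; Leaf y]
  | FApp Y x xs => Node 3 (Leaf Y :: Leaf x :: map (@Leaf nat) xs)
  | FImp p q => Node 4 [:: form_enc p; form_enc q]
  | FAllF p => Node 5 [:: form_enc p]
  | FAllS n p => Node 6 [:: Leaf n; form_enc p]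
  end.

Definition leaf_val (t : tree nat) : nat := if t is Leaf x then x else 0.

Fixpoint form_dec (t : tree nat) : form :=
  match t with
  | Node 1 [:: x; y] => FEq (leaf_val x) (leaf_val y)
  | Node 2 [:: x; y] => FIn (leaf_val x) (leaf_val y)
  | Node 3 (Y :: x :: xs) => FApp (leaf_val Y) (leaf_val x) (map leaf_val xs)
  | Node 4 [:: p; q] => FImp (form_dec p) (form_dec q)
  | Node 5 [:: p] => FAllF (form_dec p)
  | Node 6 [:: n; p] => FAllS (leaf_val n) (form_dec p)
  | _ => FBot
  end.

Lemma form_encK : cancel form_enc form_dec.
Proof.
elim=> //= [Y x xs|p -> q ->|p ->|n p ->] //.
by congr FApp; elim: xs => //= v xs ->.
Qed.

(** Numbers that code no formula default to [FBot]; the construction below uses only that every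
    formula occurs. *)
Definition form_nth (i : nat) : form := oapp form_dec FBot (unpickle i).

Lemma form_nthP p : exists i, form_nth i = p.
Proof. by exists (pickle (form_enc p)); rewrite /form_nth pickleK /= form_encK. Qed.

(** * A complete Henkin theory refuting [p0] *)

Section Henkin.
Variable T : form -> Prop.
Hypothesis T_closed : forall q, T q -> sentence q.
Variable p0 : form.
Hypothesis p0_unprovable : ~ proves T p0.

(** The finite [G] holds the formulas of a stage and [L] the axioms used. They are kept apart
    because witnesses are chosen fresh for [G] only, while the axioms are closed and immune to
    renaming. *)
Definition prov (G : seq form) q :=
  exists L, (forall r, List.In r L -> T r) /\ nd (G ++ L) q.

Lemma prov_weaken G G' q :
  (forall r, List.In r G -> List.In r G') -> prov G q -> prov G' q.
Proof.
move=> GG' [L [LT D]]; exists L; split => //; apply: nd_weaken D _ => r.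
by rewrite !List.in_app_iff => -[/GG'|]; [left|right].
Qed.

Lemma prov_nd2 G p q r :
  (forall G', nd G' p -> nd G' q -> nd G' r) -> prov G p -> prov G q -> prov G r.
Proof.
move=> pqr [L [LT D]] [L' [LT' D']]; exists (L ++ L'); split.
  by move=> x /List.in_app_iff[/LT|/LT'].
by apply: pqr; [apply: nd_weaken D _|apply: nd_weaken D' _] => x;
  rewrite !List.in_app_iff; tauto.
Qed.

Lemma prov_ax G q : List.In q G -> prov G q.
Proof. by move=> qG; exists [::]; split=> //; apply: nd_ax; rewrite cats0. Qed.

Lemma prov_impI G p q : prov (p :: G) q -> prov G (FImp p q).
Proof. by move=> [L [LT D]]; exists L; split=> //; apply: nd_impI. Qed.

Lemma prov_raa G p : prov (FNot p :: G) FBot -> prov G p.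
Proof. by move=> [L [LT D]]; exists L; split=> //; apply: nd_raa. Qed.

Definition fresh (G : seq form) := foldr maxn 0 (map mxv G).

Lemma freshP G q : List.In q G -> mxv q <= fresh G.
Proof.
elim: G => //= r G IH [->|/IH qG]; first exact: leq_maxl.
exact: leq_trans qG (leq_maxr _ _).
Qed.

Lemma prov_genF G p t : fresh (p :: G) <= t ->
  prov G (ren_fo (inst t) p) -> prov G (FAllF p).
Proof.
move=> tG [L [LT D]]; exists L; split=> //.
have Gt q : List.In q (p :: G) -> mxv q <= t by move/freshP/leq_trans; apply.
pose s := fresh (p :: G ++ L).
have sG q : List.In q (p :: G ++ L) -> mxv q <= s by apply: freshP.
apply: (@nd_genF _ _ s); first by move=> q qG; apply: sG; right.
  by apply: sG; left.
(* the axioms are closed, so renaming [t] to a variable fresh for them fixes them *)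
pose f i := if i == t then s else i.
have := nd_ren f idS D; congr nd.
  rewrite map_cat; congr cat.
    rewrite -[RHS]map_id; apply: map_eq_in => q qG; rewrite -[RHS]ren_id.
    apply: ren_bnd (fo_bnd_mxv q) (so_bnd_mxv q) _ _ => // i iq.
    by rewrite /f ltn_eqF // (leq_trans iq) // Gt //; right.
  by rewrite -[RHS]map_id; apply: map_eq_in => q /LT/T_closed; apply: ren_sentence.
rewrite !ren_foE ren_ren.
apply: ren_bnd (fo_bnd_mxv p) (so_bnd_mxv p) _ _ => // -[|i] ip /=.
  by rewrite /f eqxx.
by rewrite /f ltn_eqF // (leq_trans (ltnW ip)) // Gt //; left.
Qed.

Lemma prov_genS G n p t : fresh (p :: G) <= t ->
  prov G (ren_so n (inst t) p) -> prov G (FAllS n p).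
Proof.
move=> tG [L [LT D]]; exists L; split=> //.
have Gt q : List.In q (p :: G) -> mxv q <= t by move/freshP/leq_trans; apply.
pose s := fresh (p :: G ++ L).
have sG q : List.In q (p :: G ++ L) -> mxv q <= s by apply: freshP.
apply: (@nd_genS _ _ _ s); first by move=> q qG; apply: sG; right.
  by apply: sG; left.
pose f i := if i == t then s else i.
have := nd_ren id (single n f) D; congr nd.
  rewrite map_cat; congr cat.
    rewrite -[RHS]map_id; apply: map_eq_in => q qG; rewrite -[RHS]ren_id.
    apply: ren_bnd (fo_bnd_mxv q) (so_bnd_mxv q) _ _ => // m i iq.
    rewrite /single; case: eqP => // _.
    by rewrite /f ltn_eqF // (leq_trans iq) // Gt //; right.
  by rewrite -[RHS]map_id; apply: map_eq_in => q /LT/T_closed; apply: ren_sentence.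
rewrite !ren_soE ren_ren.
apply: ren_bnd (fo_bnd_mxv p) (so_bnd_mxv p) _ _ => // m i ip.
rewrite /single /=; case: eqP => // _; case: i ip => [|i] ip /=.
  by rewrite /f eqxx.
by rewrite /f ltn_eqF // (leq_trans (ltnW ip)) // Gt //; left.
Qed.

Definition henkin_witness (G : seq form) q : seq form :=
  match q with
  | FAllF r => FNot (ren_fo (inst (fresh (r :: G))) r) :: G
  | FAllS n r => FNot (ren_so n (inst (fresh (r :: G))) r) :: G
  | _ => G
  end.

Definition henkin_step (G : seq form) q : seq form :=
  if excluded_middle_informative (prov (q :: G) FBot) then henkin_witness G q
  else q :: G.

Fixpoint stage (i : nat) : seq form :=
  if i is j.+1 then henkin_step (stage j) (form_nth j) else [:: FNot p0].

Lemma stage_consistent i : ~ prov (stage i) FBot.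
Proof.
elim: i => [|i IH] /=.
  move=> /prov_raa[L [LT D]]; apply: p0_unprovable; exists L; split=> //.
rewrite /henkin_step; case: excluded_middle_informative => D //=.
(* If adding the witness were inconsistent, the stage would prove the fresh instance, hence by
   generalisation the very formula that [N] refutes. *)
have N := prov_impI D; rewrite /henkin_witness.
case: (form_nth i) N => //= [r|n r] N /prov_raa.
  move/(prov_genF (leqnn _)) => H; apply: IH.
  exact: (prov_nd2 (fun G' => @nd_impE G' _ _) N H).
move/(prov_genS (leqnn _)) => H; apply: IH.
exact: (prov_nd2 (fun G' => @nd_impE G' _ _) N H).
Qed.

Lemma stage_mono i j q : i <= j -> List.In q (stage i) -> List.In q (stage j).
Proof.
move=> /subnKC <-; elim: (j - i) => [|k IH]; first by rewrite addn0.
move=> /IH; rewrite addnS /= /henkin_step.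
case: excluded_middle_informative => /= ?; last by right.
by rewrite /henkin_witness; case: (form_nth _) => //= *; right.
Qed.

Definition henkin q := exists i, prov (stage i) q.

Lemma henkin_nd2 p q r : (forall G', nd G' p -> nd G' q -> nd G' r) ->
  henkin p -> henkin q -> henkin r.
Proof.
move=> pqr [i Hi] [j Hj]; exists (maxn i j).
apply: prov_nd2 pqr _ _; [apply: prov_weaken Hi|apply: prov_weaken Hj] => x;
  apply: stage_mono; rewrite ?leq_maxl ?leq_maxr //.
Qed.

Lemma henkin_nd1 p r : (forall G', nd G' p -> nd G' r) -> henkin p -> henkin r.
Proof. by move=> pr Hp; apply: (henkin_nd2 (p := p) (q := p)) => // G' /pr. Qed.

Lemma henkin_nd0 p : (forall G', nd G' p) -> henkin p.
Proof. by move=> Hp; exists 0, [::]; split. Qed.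

Lemma henkin_consistent : ~ henkin FBot.
Proof. by move=> [i]; apply: stage_consistent. Qed.

Lemma henkin_MP p q : henkin (FImp p q) -> henkin p -> henkin q.
Proof. by apply: henkin_nd2 => G; apply: nd_impE. Qed.

Lemma henkin_decide i : henkin (form_nth i) \/
  henkin (FNot (form_nth i)) /\
  exists G, stage i.+1 = henkin_witness G (form_nth i).
Proof.
case: (excluded_middle_informative (prov (form_nth i :: stage i) FBot)) => D.
  right; split; first by exists i; apply: prov_impI.
  by exists (stage i); rewrite /= /henkin_step; case: excluded_middle_informative.
left; exists i.+1; apply: prov_ax; rewrite /= /henkin_step.
by case: excluded_middle_informative => //= ?; left.
Qed.

Lemma henkin_compl p : henkin p \/ henkin (FNot p).
Proof. by have [i <-] := form_nthP p; case: (henkin_decide i) => [|[]]; tauto. Qed.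

Lemma henkin_imp p q : henkin (FImp p q) <-> (henkin p -> henkin q).
Proof.
split=> [|H]; first exact: henkin_MP.
have [/H Hq|Np] := henkin_compl p.
  apply: henkin_nd1 Hq => G D; apply: nd_impI.
  by apply: nd_weaken D _ => r; right.
apply: henkin_nd1 Np => G D; apply/nd_impI/nd_raa.
apply: (nd_impE (p := p)); last by apply: nd_ax; right; left.
by apply: nd_weaken D _ => r; do 2 right.
Qed.

Lemma henkin_allF r : henkin (FAllF r) <-> forall t, henkin (ren_fo (inst t) r).
Proof.
split=> [H t|H]; first by apply: henkin_nd1 H => G; apply: nd_allFE.
have [i Ei] := form_nthP (FAllF r).
case: (henkin_decide i); rewrite Ei // => -[N [G /= EG]].
case: henkin_consistent; apply: henkin_MP (H (fresh (r :: G))).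
by exists i.+1; apply: prov_ax; rewrite /= EG; left.
Qed.

Lemma henkin_allS n r :
  henkin (FAllS n r) <-> forall t, henkin (ren_so n (inst t) r).
Proof.
split=> [H t|H]; first by apply: henkin_nd1 H => G; apply: nd_allSE.
have [i Ei] := form_nthP (FAllS n r).
case: (henkin_decide i); rewrite Ei // => -[N [G /= EG]].
case: henkin_consistent; apply: henkin_MP (H (fresh (r :: G))).
by exists i.+1; apply: prov_ax; rewrite /= EG; left.
Qed.

Lemma henkin_subst x y p : henkin (FEq x y) ->
  henkin (ren_fo (inst x) p) -> henkin (ren_fo (inst y) p).
Proof. by apply: henkin_nd2 => G; apply: nd_subst. Qed.

Lemma henkin_refl x : henkin (FEq x x).
Proof. by apply: henkin_nd0 => G; apply: nd_refl. Qed.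

Lemma henkin_sym x y : henkin (FEq x y) -> henkin (FEq y x).
Proof. by move=> xy; apply: (@henkin_subst x y (FEq 0 x.+1)) => //; apply: henkin_refl. Qed.

Lemma henkin_trans x y z : henkin (FEq x y) -> henkin (FEq y z) -> henkin (FEq x z).
Proof. by move=> xy yz; apply: (@henkin_subst y z (FEq x.+1 0)). Qed.

(** * The term model and the truth lemma *)

Definition eqclass x : nat -> Prop := fun y => henkin (FEq x y).

(** The quotient of the variables by provable identity is built from predicates, so that
    extensionality turns [FEq] into equality of elements. *)
Definition henkin_dom := {P : nat -> Prop | exists x, P = eqclass x}.

Definition cls x : henkin_dom := exist _ (eqclass x) (ex_intro _ x erefl).

Definition rep (d : henkin_dom) : nat :=
  proj1_sig (constructive_indefinite_description _ (proj2_sig d)).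

Lemma repK d : cls (rep d) = d.
Proof.
rewrite /rep; case: constructive_indefinite_description => x; case: d => P ex /= Px.
by apply: eq_sig => [|eP] //=; apply: proof_irrelevance.
Qed.

Lemma cls_eq x y : cls x = cls y <-> henkin (FEq x y).
Proof.
split=> [/(congr1 (@proj1_sig _ _)) /= E|xy].
  by rewrite -/(eqclass x y) E; apply: henkin_refl.
apply: eq_sig => [|eP] /=; last exact: proof_irrelevance.
apply: functional_extensionality => z; apply: propositional_extensionality.
by split=> H; [apply: henkin_trans (henkin_sym xy) H|apply: henkin_trans xy H].
Qed.

Lemma eq_rep x : henkin (FEq x (rep (cls x))).
Proof. by apply/cls_eq; rewrite repK. Qed.

(** Relation objects are the second-order variables themselves. The value [True] on the empty list
    is arbitrary, since [FApp] always supplies at least one argument. *)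
Definition henkin_model : model := {|
  dom := henkin_dom;
  ein := fun d e => henkin (FIn (rep d) (rep e));
  robj := nat;
  rsort := fun _ _ => True;
  rapp := fun Y ds => if map rep ds is x :: xs then henkin (FApp Y x xs) else True |}.

Lemma henkin_FIn x y x' y' : henkin (FEq x x') -> henkin (FEq y y') ->
  henkin (FIn x y) -> henkin (FIn x' y').
Proof.
move=> xx yy xy; apply: (@henkin_subst y y' (FIn x'.+1 0)) => //=.
exact: (@henkin_subst x x' (FIn 0 y.+1)).
Qed.

(** Substitution of equals treats one variable at a time, so the arguments are exchanged one by one.
    This is the passage from variables to the representatives seen by [rapp]. *)
Lemma henkin_FApp (h : nat -> nat) Y x xs : (forall v, henkin (FEq v (h v))) ->
  henkin (FApp Y x xs) <-> henkin (FApp Y (h x) (map h xs)).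
Proof.
move=> vh.
have inst_succ t (s : seq nat) : map (inst t) (map S s) = s.
  by rewrite -map_comp map_id.
have heads a b s : henkin (FEq a b) -> henkin (FApp Y a s) -> henkin (FApp Y b s).
  move=> ab; have := @henkin_subst a b (FApp Y 0 (map S s)) ab.
  by rewrite /= !inst_succ.
have step a b c (u w : seq nat) : henkin (FEq a b) ->
    henkin (FApp Y c (u ++ a :: w)) -> henkin (FApp Y c (u ++ b :: w)).
  move=> ab; have := @henkin_subst a b (FApp Y c.+1 (map S u ++ 0 :: map S w)) ab.
  by rewrite /= !map_cat /= !inst_succ.
have tails c (u w : seq nat) :
    henkin (FApp Y c (u ++ w)) <-> henkin (FApp Y c (u ++ map h w)).
  elim: w u => [//|a w IH] u /=; rewrite -cat_rcons IH cat_rcons.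
  by split; apply: step => //; apply: henkin_sym.
rewrite (tails x [::] xs) /=; split; apply: heads => //; exact: henkin_sym.
Qed.

(** The truth lemma is generalised over renamings because the instances of a quantified formula are
    renamings of its body. *)
Lemma henkin_sat f g p :
  sat (M := henkin_model) (cls \o f) g p <-> henkin (ren f g p).
Proof.
elim: p f g => [|x y|x y|Y x xs|p IHp q IHq|p IH|n p IH] f g.
- by split=> // /henkin_consistent.
- exact: cls_eq.
- split; apply: henkin_FIn; try exact: eq_rep; apply/henkin_sym/eq_rep.
- have := @henkin_FApp (fun v => rep (cls v)) (g (size xs) Y) (f x) (map f xs) eq_rep.
  by rewrite /= -!map_comp => <-.
- by rewrite /= henkin_imp IHp IHq.
- rewrite /= henkin_allF.
  suff H t : sat (M := henkin_model) (scons (cls t) (cls \o f)) g p <->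
      henkin (ren_fo (inst t) (ren (up f) g p)).
    by split=> [Hd t|Ht d]; [apply/H/Hd|rewrite -(repK d); apply/H/Ht].
  rewrite ren_foE ren_ren -IH.
  set r := scons _ _; set r' := _ \o _; suff -> : r = r' by [].
  by apply: functional_extensionality => -[].
- rewrite /= henkin_allS.
  suff H t : sat (M := henkin_model) (cls \o f) (sconsS n t g) p <->
      henkin (ren_so n (inst t) (ren f (upS n g) p)).
    by split=> [Hd t|Ht d _]; apply/H; [apply: Hd|apply: Ht].
  rewrite ren_soE ren_ren -IH.
  have -> : (fun m => single n (inst t) m \o upS n g m) = sconsS n t g; last by [].
  apply: functional_extensionality => m; rewrite /sconsS /single /upS.
  by case: eqP => // ->; apply: functional_extensionality => -[].
Qed.

Lemma henkin_countermodel :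
  (forall q, T q -> sat (M := henkin_model) cls idS q) /\
  ~ sat (M := henkin_model) cls idS p0.
Proof.
have satE q : sat (M := henkin_model) cls idS q <-> henkin q.
  by have := henkin_sat id idS q; rewrite ren_id.
split=> [q Tq|]; rewrite satE.
  exists 0, [:: q]; split=> [r [<-|//] //|]; apply: nd_ax.
  by right; left.
move=> H; apply: henkin_consistent; apply: henkin_MP H.
by exists 0; apply: prov_ax; left.
Qed.
End Henkin.

Theorem completeness T p : (forall q, T q -> sentence q) ->
  (forall M (r : nat -> dom M) s, valid s -> (forall q, T q -> sat r s q) ->
     sat r s p) -> proves T p.
Proof.
move=> Tc H; apply: NNPP => Np; have [HT] := henkin_countermodel Tc Np.
by apply; apply: H.
Qed.

(** * Satisfaction of the set-theoretic formulas *)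

(** A dummy relation sort lets first-order satisfaction reuse every lemma about [sat]. *)
Definition fo_model (D : Type) (E : D -> D -> Prop) : model := {|
  dom := D; ein := E; robj := unit;
  rsort := fun _ _ => True; rapp := fun _ _ => False |}.

Definition fsat (D : Type) (E : D -> D -> Prop) (r : nat -> D) (p : form) : Prop :=
  sat (M := fo_model E) r (fun _ _ => tt) p.

Lemma sat_FO M (r : nat -> dom M) s p : isFO p -> sat r s p <-> fsat (@ein M) r p.
Proof.
rewrite /fsat; elim: p r s => //= [p IHp q IHq|p IH] r s.
  by move=> /andP[/IHp-> /IHq->].
by move=> /IH H; split=> Hd d; apply/H/Hd.
Qed.

Section SetNotions.
Variables (D : Type) (E : D -> D -> Prop).

Definition subs x y := forall z, E z x -> E z y.
Definition history h :=
  forall x, E x h -> forall y, E y x <-> exists c, subs y c /\ E c x /\ E c h.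
Definition level s :=
  exists h, history h /\ forall y, E y s <-> exists c, subs y c /\ E c h.
Definition potent a := forall x c, subs x c -> E c a -> E x a.
Definition trset a := forall x y, E x y -> E y a -> E x a.
Definition sing w a := forall x, E x w <-> x = a.
Definition doub w a b := forall x, E x w <-> x = a \/ x = b.
Definition kpair z a b := forall w, E w z <-> sing w a \/ doub w a b.

Fixpoint tup (z : D) (ds : seq D) : Prop :=
  match ds with
  | [::] => False
  | [:: a] => z = a
  | a :: bs => exists w, tup w bs /\ kpair z a w
  end.

Definition tupset n y :=
  forall z, E z y -> exists ds, size ds = n.+1 /\ tup z ds.
End SetNotions.

(** Follows the binders of [AllFn] and [ExFn]: the last entry of [ds] gets index 0, the first entry
    the highest index. *)
Fixpoint push (A : Type) (ds : seq A) (r : nat -> A) : nat -> A :=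
  if ds is d :: ds' then push ds' (scons d r) else r.

Lemma pushD (A : Type) (ds : seq A) r v : push ds r (v + size ds) = r v.
Proof. by elim: ds r v => [|d ds IH] r v /=; rewrite ?addn0 // addnS -addSn IH. Qed.

Lemma push_lt (A : Type) (ds : seq A) r r' v :
  v < size ds -> push ds r v = push ds r' v.
Proof.
elim: ds r r' v => [//|d ds IH] r r' v /=; rewrite ltnS leq_eqVlt.
case/orP => [/eqP->|]; last exact: IH.
by rewrite -[size ds]add0n !pushD.
Qed.

Lemma rev_iotaS n : rev (iota 0 n.+1) = n :: rev (iota 0 n).
Proof. by rewrite -addn1 iotaD rev_cat. Qed.

Lemma push_iota (A : Type) (ds : seq A) r :
  map (push ds r) (rev (iota 0 (size ds))) = ds.
Proof.
elim: ds r => [//|d ds IH] r; rewrite [size _]/= rev_iotaS /= IH.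
by rewrite -[size ds]add0n pushD.
Qed.

Lemma push_args (A : Type) n (ds : seq A) r : size ds = n.+1 ->
  map (push ds r) (n :: rev (iota 0 n)) = ds.
Proof. by move=> dn; rewrite -rev_iotaS -dn push_iota. Qed.

Definition allin (A : Type) (P : A -> Prop) (ds : seq A) := forall d, List.In d ds -> P d.

Lemma In_map (A B : Type) (f : A -> B) s y :
  List.In y (map f s) <-> exists x, f x = y /\ List.In x s.
Proof. exact: List.in_map_iff. Qed.

Lemma In_mem (T : eqType) (x : T) (s : seq T) : List.In x s <-> x \in s.
Proof.
elim: s => [|y s IH] /=; first by split.
rewrite inE IH; split=> [[->|->]|/orP[/eqP->|]]; rewrite ?eqxx ?orbT //; by [left|right].
Qed.

Section SatSets.
Variable M : model.
Implicit Types (r : nat -> dom M) (s : nat -> nat -> robj M).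
Notation E := (@ein M).

Lemma sat_Subset r s x y : sat r s (Subset x y) <-> subs E (r x) (r y).
Proof. by []. Qed.

Lemma sat_app r s Y x xs :
  sat r s (FApp Y x xs) <-> rapp (s (size xs) Y) (map r (x :: xs)).
Proof. by []. Qed.

Lemma sat_InPotCap r s y x h : sat r s (InPotCap y x h) <->
  exists c, subs E (r y) c /\ E c (r x) /\ E c (r h).
Proof.
rewrite sat_ex; setoid_rewrite sat_and; setoid_rewrite sat_and.
by setoid_rewrite sat_Subset.
Qed.

Lemma sat_InPot r s y a : sat r s (InPot y a) <->
  exists c, subs E (r y) c /\ E c (r a).
Proof. by rewrite sat_ex; setoid_rewrite sat_and; setoid_rewrite sat_Subset. Qed.

Lemma sat_History r s h : sat r s (History h) <-> history E (r h).
Proof.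
rewrite sat_allF; setoid_rewrite sat_imp; setoid_rewrite sat_allF.
by setoid_rewrite sat_iff; setoid_rewrite sat_InPotCap.
Qed.

Lemma sat_Level r s x : sat r s (Level x) <-> level E (r x).
Proof.
rewrite sat_ex; setoid_rewrite sat_and; setoid_rewrite sat_History.
setoid_rewrite sat_allF; setoid_rewrite sat_iff; by setoid_rewrite sat_InPot.
Qed.

Lemma sat_Sing r s w a : sat r s (Sing w a) <-> sing E (r w) (r a).
Proof. by rewrite sat_allF; setoid_rewrite sat_iff. Qed.

Lemma sat_Doub r s w a b : sat r s (Doub w a b) <-> doub E (r w) (r a) (r b).
Proof. by rewrite sat_allF; setoid_rewrite sat_iff; setoid_rewrite sat_or. Qed.

Lemma sat_IsPair r s z a b : sat r s (IsPair z a b) <-> kpair E (r z) (r a) (r b).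
Proof.
rewrite sat_allF; setoid_rewrite sat_iff; setoid_rewrite sat_or.
by setoid_rewrite sat_Sing; setoid_rewrite sat_Doub.
Qed.

Lemma sat_TupEqK r s k z x xs : sat r s (TupEqK k z x xs) <->
  tup E (r z) [seq r (v + k) | v <- x :: xs].
Proof.
elim: xs r k z x => [//|y ys IH] r k z x.
rewrite [sat _ _ _]sat_ex.
suff H d : sat (scons d r) s (FAnd (TupEqK k.+1 0 y ys) (IsPair z.+1 (x + k).+1 0))
    <-> tup E d [seq r (v + k) | v <- y :: ys] /\ kpair E (r z) (r (x + k)) d.
  by split=> -[d /H]; exists d => //; apply/H.
rewrite sat_and IH sat_IsPair.
suff -> : [seq scons d r (v + k.+1) | v <- y :: ys] = [seq r (v + k) | v <- y :: ys] by [].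
by apply: eq_map => v; rewrite addnS.
Qed.

Lemma sat_TupEq r s z x xs : sat r s (TupEq z x xs) <-> tup E (r z) (map r (x :: xs)).
Proof.
rewrite sat_TupEqK.
suff -> : [seq r (v + 0) | v <- x :: xs] = map r (x :: xs) by [].
by apply: eq_map => v; rewrite addn0.
Qed.

Lemma sat_AllFn r s n p : sat r s (AllFn n p) <->
  forall ds, size ds = n -> sat (push ds r) s p.
Proof.
elim: n r => [|n IH] r /=.
  by split=> [H [|//]//|H]; apply: (H [::]).
split=> [H [//|d ds] [dn]|H d]; first by move/IH: (H d); apply.
by apply/IH => ds dn; apply: (H (d :: ds)); rewrite /= dn.
Qed.

Lemma sat_ExFn r s n p : sat r s (ExFn n p) <->
  exists ds, size ds = n /\ sat (push ds r) s p.
Proof.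
elim: n r => [|n IH] r.
  by split=> [H|[[|d ds] [dn H]]] //; exists [::].
rewrite [ExFn _ _]/= sat_ex; setoid_rewrite IH.
split=> [[d [ds [dn H]]]|[[|d ds] [//=dn H]]].
  by exists (d :: ds); rewrite /= dn.
by exists d, ds; split=> //; case: dn.
Qed.

Lemma sat_IsTupN r s n z : sat r s (IsTupN n z) <->
  exists ds, size ds = n.+1 /\ tup E (r z) ds.
Proof.
rewrite sat_ExFn; suff H ds : size ds = n.+1 ->
    sat (push ds r) s (TupEq (z + n.+1) n (rev (iota 0 n))) <-> tup E (r z) ds.
  by split=> -[ds [dn]] /(H _ dn); exists ds.
by move=> dn; rewrite sat_TupEq push_args // -dn pushD.
Qed.

Lemma sat_TupSet r s n y : sat r s (TupSet n y) <-> tupset E n (r y).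
Proof. by rewrite sat_allF; setoid_rewrite sat_imp; setoid_rewrite sat_IsTupN. Qed.

Lemma sat_BigAnd r s (ps : seq form) :
  sat r s (BigAnd ps) <-> forall p, List.In p ps -> sat r s p.
Proof.
elim: ps => [|p ps IH]; first by split=> // _; apply.
rewrite [BigAnd _]/= sat_and IH; split=> [[Hp Hps] q [<-//|]|H]; first exact: Hps.
by split=> [|q qps]; apply: H; [left|right].
Qed.

Lemma sat_allsub r s n x (ds : seq (dom M)) : size ds = n.+1 ->
  sat (push ds r) s (BigAnd [seq Subset i x | i <- iota 0 n.+1]) <->
  allin (fun d => subs E d (push ds r x)) ds.
Proof.
move=> dn; rewrite sat_BigAnd /allin -{2}(push_iota ds r) dn.
split=> H d /In_map[i [<-]] iP.
  apply: (H (Subset i x)); apply/In_map; exists i; split=> //.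
  by apply/In_mem; rewrite -mem_rev; apply/In_mem.
apply: H; apply/In_map; exists i; split=> //.
by apply/In_mem; rewrite mem_rev; apply/In_mem.
Qed.

Lemma sat_SubRel r s n F x : sat r s (SubRel n F x) <->
  forall ds, size ds = n.+1 -> rapp (s n F) ds -> allin (fun d => subs E d (r x)) ds.
Proof.
rewrite sat_AllFn.
suff H ds : size ds = n.+1 -> sat (push ds r) s (FImp (FApp F n (rev (iota 0 n)))
     (BigAnd [seq Subset i (x + n.+1) | i <- iota 0 n.+1])) <->
   (rapp (s n F) ds -> allin (fun d => subs E d (r x)) ds).
  by split=> Hd ds dn; apply/H/Hd.
move=> dn; rewrite sat_imp sat_allsub //.
by rewrite -dn pushD sat_app push_args // size_rev size_iota.
Qed.

(** The right-hand side of [Codes], named because it also serves as a comprehension formula in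
    [codes_onto]. *)
Definition in_tup n y :=
  FEx (FAnd (TupEq 0 n.+1 (map S (rev (iota 0 n)))) (FIn 0 (y + n.+2))).

Lemma sat_in_tup r s n y ds : size ds = n.+1 ->
  sat (push ds r) s (in_tup n y) <-> exists z, tup E z ds /\ E z (r y).
Proof.
move=> dn; rewrite sat_ex; setoid_rewrite sat_and; setoid_rewrite sat_TupEq.
suff H z : (tup E (scons z (push ds r) 0)
    [seq scons z (push ds r) i | i <- n.+1 :: [seq i.+1 | i <- rev (iota 0 n)]] /\
    sat (scons z (push ds r)) s (FIn 0 (y + n.+2))) <-> (tup E z ds /\ E z (r y)).
  by setoid_rewrite H.
have -> : [seq scons z (push ds r) i | i <- n.+1 :: [seq i.+1 | i <- rev (iota 0 n)]]
  = ds by rewrite -[RHS](push_args r dn) -[_ :: map _ _]/(map S (n :: _)) -map_comp.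
by rewrite [sat _ _ _]/= addnS /= -dn pushD.
Qed.

Definition codes (n : nat) (u : robj M) (y : dom M) :=
  forall ds, size ds = n.+1 -> (rapp u ds <-> exists z, tup E z ds /\ E z y).

Lemma sat_Codes r s n F y : sat r s (Codes n F y) <-> codes n (s n F) (r y).
Proof.
rewrite sat_AllFn.
have H ds : size ds = n.+1 ->
    sat (push ds r) s (FIff (FApp F n (rev (iota 0 n))) (in_tup n y)) <->
    (rapp (s n F) ds <-> exists z, tup E z ds /\ E z (r y)).
  move=> dn; rewrite sat_iff sat_in_tup // sat_app push_args //.
  by rewrite size_rev size_iota.
by split=> Hd ds dn; apply/H/Hd.
Qed.
End SatSets.

(** * Levels *)

(** Index 0 is the argument and [r] supplies the parameters; this turns the Separation schema into a
    statement about predicates. *)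
Definition dfn (D : Type) (E : D -> D -> Prop) (P : D -> Prop) :=
  exists psi r, isFO psi /\ forall x, P x <-> fsat E (scons x r) psi.

Section Levels.
Variables (D : Type) (E : D -> D -> Prop).
Notation subs := (subs E).
Notation level := (level E).
Notation history := (history E).
Notation potent := (potent E).
Notation trset := (trset E).
Notation dfn := (dfn E).

Hypothesis ext : forall x y, (forall z, E z x <-> E z y) -> x = y.
Hypothesis strat : forall x, exists s, level s /\ subs x s.
(* The bound by a level is what bounded comprehension provides before the
   transitivity of levels is available. *)
Hypothesis bounded_sep : forall P, dfn P -> forall s a, level s ->
  exists b, forall x, E x b <-> P x /\ subs x s /\ E x a.

Lemma sub_trans x y z : subs x y -> subs y z -> subs x z.
Proof. by move=> xy yz w /xy/yz. Qed.

Lemma dfn_meet F : dfn F -> dfn (fun x => forall y, F y -> E x y).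
Proof.
move=> [psi [r [psiFO H]]].
(* Under the quantifier 0 is [y] and 1 is [x], so the parameters of [psi] skip index 1. *)
exists (FAllF (FImp (ren_fo (fun i => if i is 0 then 0 else i.+1) psi) (FIn 1 0))), r.
split=> [|x]; first by rewrite /= ren_foE isFO_ren psiFO.
rewrite /fsat sat_allF; setoid_rewrite sat_imp; setoid_rewrite sat_ren_fo.
suff H' y : F y <-> sat (M := fo_model E) (scons y (scons x r) \o
    (fun i => if i is 0 then 0 else i.+1)) (fun=> fun=> tt) psi by setoid_rewrite H'.
rewrite H /fsat; set e := scons y r; set e' := _ \o _.
by have -> : e = e' by apply: functional_extensionality => -[].
Qed.

(* If there were no minimal element, the Russell set of the intersection would
   belong to that intersection. *)
Lemma potent_min F : dfn F -> (forall x, F x -> potent x) -> (exists x, F x) ->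
  exists x, F x /\ forall y, F y -> ~ E y x.
Proof.
move=> dF potF [a Fa]; apply: NNPP => N.
have nomin y : F y -> exists z, F z /\ E z y.
  move=> Fy; apply: NNPP => Nz; apply: N; exists y; split=> // z Fz zy.
  by apply: Nz; exists z.
have [s [ls as_]] := strat a.
have [c Hc] := bounded_sep (dfn_meet dF) a ls.
have dR : dfn (fun x => ~ E x x) by exists (FNot (FIn 0 0)), (fun=> a).
have [d Hd] := bounded_sep dR c ls.
have dc : subs d c by move=> x /Hd[_ []].
have ca : subs c a by move=> x /Hc[_ []].
have cF y : F y -> E c y.
  move=> /[dup] Fy /nomin[z [Fz zy]]; apply: potF zy => // x /Hc[xF _].
  exact: xF.
have dF' y : F y -> E d y by move=> Fy; apply: (potF _ Fy) dc (cF y Fy).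
(* [d] lies inside [s] by way of [c] and [a], so it meets the bound of both separations without
   transitivity of [s]. *)
have ds : subs d s by apply: sub_trans (sub_trans dc ca) as_.
have Edc : E d c by apply/Hc; split=> //; split=> //; apply: dF'.
have Ndd : ~ E d d by move=> /[dup] dd /Hd[].
by apply: (Ndd); apply/Hd.
Qed.

Lemma level_potent s : level s -> potent s.
Proof.
move=> [h [hh H]] x c xc /H[c' [cc' c'h]]; apply/H; exists c'; split=> //.
exact: sub_trans cc'.
Qed.

Lemma history_potent h x : history h -> E x h -> potent x.
Proof.
move=> hh xh y c yc /(hh x xh)[c' [cc' c'h]]; apply/(hh x xh); exists c'; split=> //.
exact: sub_trans cc'.
Qed.

(** Take a minimal non-transitive member [a] of [h]. Any [z] in [a] is a subset of some [c] in both
    [a] and [h], and [c] is transitive by minimality; so members of [z] are subsets of [c], and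
    potency puts them in [a]. *)
Lemma history_transitive h x : history h -> E x h -> trset x.
Proof.
move=> hh xh; apply: NNPP => Nx.
pose F x := E x h /\ ~ trset x.
have dF : dfn F.
  exists (FAnd (FIn 0 1) (FNot (FAllF (FAllF (FImp (FIn 1 0) (FImp (FIn 0 2) (FIn 1 2))))))).
  by exists (fun=> h); split=> // y; rewrite /fsat sat_and.
have [||a [[ah Na] mina]] := potent_min dF.
- by move=> y [yh _]; apply: history_potent yh.
- by exists x.
apply: Na => y z yz /[dup] za /(hh a ah)[c [zc [ca ch]]].
have tc : trset c by apply: NNPP => Nc; apply: (mina c).
apply: (history_potent hh ah) ca => w wy; exact: tc wy (zc y yz).
Qed.

Lemma level_transitive s : level s -> trset s.
Proof.
move=> [h [hh H]] x y xy /H[c [yc ch]]; apply/H; exists c; split=> // z zx.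
exact: history_transitive hh ch z x zx (yc x xy).
Qed.

Lemma level_sub s x : level s -> E x s -> subs x s.
Proof. by move=> ls xs y yx; apply: level_transitive ls y x yx xs. Qed.

(** The history witnessing that [c] is a level is the intersection of [c] with [h]. *)
Lemma history_level h c : history h -> E c h -> level c.
Proof.
move=> hh ch; have [s [ls cs]] := strat c.
have [k Hk] : exists k, forall x, E x k <-> E x c /\ E x h.
  have dP : dfn (fun x => E x h) by exists (FIn 0 1), (fun=> h).
  have [k Hk] := bounded_sep dP c ls; exists k => x; rewrite Hk.
  split=> [[? []]//|[xc xh]]; split=> //; split=> //.
  by apply: level_sub => //; apply: cs.
exists k; split=> [x /Hk[xc xh] y|y].
  rewrite (hh x xh); split=> -[z [yz [zx zh]]]; exists z; split=> //; split=> //.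
    by apply/Hk; split=> //; apply: history_transitive hh ch _ _ zx xc.
  by move/Hk: zh => [].
rewrite (hh c ch); split=> -[z [yz H]]; exists z; split=> //; exact/Hk.
Qed.

Lemma level_acc s x : level s -> E x s -> exists t, level t /\ subs x t /\ E t s.
Proof.
move=> [h [hh H]] /H[c [xc ch]]; exists c; split; first exact: history_level ch.
by split=> //; apply/H; exists c; split.
Qed.

(** Double minimality: [u] is a minimal level with an incomparable partner, and [v] a minimal such
    partner of [u]. Every level inside one of them is comparable with the other, which forces [u]
    and [v] to have the same members. *)
Lemma level_comparable s t : level s -> level t -> E s t \/ s = t \/ E t s.
Proof.
pose comp s t := E s t \/ s = t \/ E t s; rewrite -/(comp s t).
pose comp_form := FOr (FIn 1 0) (FOr (FEq 1 0) (FIn 0 1)).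
move=> ls lt; apply: NNPP => Nst.
pose F x := level x /\ exists y, level y /\ ~ comp x y.
have dF : dfn F.
  exists (FAnd (Level 0) (FEx (FAnd (Level 0) (FNot comp_form)))), (fun=> s).
  split=> // x; rewrite /fsat /comp_form sat_and sat_ex; setoid_rewrite sat_and.
  setoid_rewrite sat_Level; setoid_rewrite sat_not; setoid_rewrite sat_or.
  by setoid_rewrite sat_or.
have [||u [[lu [v0 [lv0 Nuv0]]] minu]] := potent_min dF.
- by move=> x [lx _]; apply: level_potent.
- by exists s; split=> //; exists t.
pose G y := level y /\ ~ comp u y.
have dG : dfn G.
  exists (FAnd (Level 0) (FNot comp_form)), (fun=> u).
  split=> // y; rewrite /fsat sat_and sat_Level sat_not.
  by rewrite /comp_form sat_or sat_or.
have [||v [[lv Nuv] minv]] := potent_min dG.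
- by move=> x [lx _]; apply: level_potent.
- by exists v0.
apply: (Nuv); right; left; apply: ext => x; split.
  move=> /(level_acc lu)[r [lr [xr ru]]]; apply: (level_potent lv) xr _.
  have : comp r v.
    by apply: NNPP => Nrv; apply: (minu r) => //; split=> //; exists v.
  case=> // -[rv|vr]; case: Nuv; right; right; first by rewrite -rv.
  exact: level_transitive lu _ _ vr ru.
move=> /(level_acc lv)[r [lr [xr rv]]]; apply: (level_potent lu) xr _.
have : comp u r by apply: NNPP => Nur; apply: (minv r).
case=> [ur|[ur|//]]; case: Nuv; left; last by rewrite ur.
exact: level_transitive lv _ _ ur rv.
Qed.
End Levels.

(** * Tuples *)

Record isLT (D : Type) (E : D -> D -> Prop) : Prop := IsLT {
  lt_ext : forall x y, (forall z, E z x <-> E z y) -> x = y;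
  lt_strat : forall x, exists s, level E s /\ subs E x s;
  lt_endless : forall s, level E s -> exists t, level E t /\ E s t;
  lt_sep : forall P, dfn E P -> forall a, exists b, forall x, E x b <-> P x /\ E x a }.

Section Tuples.
Variables (D : Type) (E : D -> D -> Prop).
Hypothesis LT : isLT E.
Notation subs := (subs E).
Notation level := (level E).
Notation sing := (sing E).
Notation doub := (doub E).
Notation kpair := (kpair E).
Notation tup := (tup E).

Let ext := lt_ext LT.
Let strat := lt_strat LT.
Let endless := lt_endless LT.

(** Makes the results on levels, proved from bounded separation alone, available in every [isLT]
    structure. *)
Lemma lt_bounded_sep P : dfn E P -> forall s a, level s ->
  exists b, forall x, E x b <-> P x /\ subs x s /\ E x a.
Proof.
move=> dP s a ls; have [b Hb] := lt_sep LT dP a.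
have dS : dfn E (subs^~ s) by exists (Subset 0 1), (fun=> s).
have [c Hc] := lt_sep LT dS b.
by exists c => x; rewrite Hc Hb; tauto.
Qed.
Let lpot := @level_potent D E.
Let ltr := level_transitive strat lt_bounded_sep.
Let lsub := level_sub strat lt_bounded_sep.
Let lcomp := level_comparable ext strat lt_bounded_sep.

Lemma level_of x : exists s, level s /\ E x s.
Proof.
have [s [ls xs]] := strat x; have [t [lt st]] := endless ls.
by exists t; split=> //; apply: lpot xs st.
Qed.

Lemma level_of2 x y : exists s, level s /\ E x s /\ E y s.
Proof.
have [s [ls xs]] := level_of x; have [t [lt yt]] := level_of y.
have [st|[st|ts]] := lcomp ls lt.
- by exists t; split=> //; split=> //; apply: ltr st.
- by exists s; rewrite {3}st.
- by exists s; split=> //; split=> //; apply: ltr ts.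
Qed.

Lemma doub_ex a b : exists w, doub w a b.
Proof.
have [s [ls [as_ bs]]] := level_of2 a b.
have dP : dfn E (fun x => x = a \/ x = b).
  exists (FOr (FEq 0 1) (FEq 0 2)), (scons a (fun=> b)).
  by split=> // x; rewrite /fsat sat_or.
have [w Hw] := lt_sep LT dP s; exists w => x; rewrite Hw.
by split=> [[]//|xab]; split=> //; case: xab => ->.
Qed.

Lemma sing_ex a : exists w, sing w a.
Proof. by have [w Hw] := doub_ex a a; exists w => x; rewrite Hw; tauto. Qed.

Lemma doub_level w a b s t :
  doub w a b -> level s -> E a s -> E b s -> level t -> E s t -> E w t.
Proof. by move=> Hw ls as_ bs lt; apply: lpot => // x /Hw[->|->]. Qed.

Lemma sing_doub w a : sing w a <-> doub w a a.
Proof. by split=> H x; rewrite H; tauto. Qed.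

Lemma kpair_ex a b s t u : level s -> E a s -> E b s -> level t -> E s t ->
  level u -> E t u -> exists z, kpair z a b /\ E z u.
Proof.
move=> ls as_ bs lt st lu tu.
have [v Hv] := sing_ex a; have [w Hw] := doub_ex a b.
have [z Hz] := doub_ex v w; exists z; split.
  move=> x; rewrite Hz; split=> [[->|->]|[xa|xab]]; [by left|by right|left|right].
    by apply: ext => y; rewrite xa Hv.
  by apply: ext => y; rewrite xab Hw.
apply: (doub_level Hz lt _ _ lu tu).
  exact: (doub_level (iffLR (sing_doub v a) Hv) ls as_ as_ lt st).
exact: doub_level Hw ls as_ bs lt st.
Qed.

Lemma kpair_fun z z' a b : kpair z a b -> kpair z' a b -> z = z'.
Proof. by move=> Hz Hz'; apply: ext => x; rewrite Hz Hz'. Qed.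

Lemma kpair_inj z a b a' b' : kpair z a b -> kpair z a' b' -> a = a' /\ b = b'.
Proof.
move=> Hz Hz'; have [v Hv] := sing_ex a.
have aa' : a = a'.
  have /Hz'[va'|va'b'] : E v z by apply/Hz; left.
    by symmetry; apply/Hv/va'.
  by symmetry; apply/Hv/va'b'; left.
(* Both [{a, b}] and [{a, b'}] belong to [z], whichever way it is read as a pair; so [b] is [a] or
   [b'], and [b'] is [a] or [b]. *)
subst a'; split=> //; have [w Hw] := doub_ex a b; have [w' Hw'] := doub_ex a b'.
have bw : E b w by apply/Hw; right.
have b'w' : E b' w' by apply/Hw'; right.
have /Hz' Hwz : E w z by apply/Hz; right.
have /Hz Hwz' : E w' z by apply/Hz'; right.
have {Hwz} : b = a \/ b = b' by case: Hwz => H; [left|]; apply/H.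
have {Hwz'} : b' = a \/ b' = b by case: Hwz' => H; [left|]; apply/H.
by case=> -> [].
Qed.

Lemma kpair_level z a b s : level s -> E z s -> kpair z a b -> E a s /\ E b s.
Proof.
move=> ls zs Hz; have [w Hw] := doub_ex a b.
have ws : E w s by apply: ltr zs => //; apply/Hz; right.
by split; apply: ltr ws => //; apply/Hw; [left|right].
Qed.

Lemma tup_cons2 z a b bs :
  tup z [:: a, b & bs] <-> exists w, tup w (b :: bs) /\ kpair z a w.
Proof. by []. Qed.

Lemma tup_fun z z' ds : tup z ds -> tup z' ds -> z = z'.
Proof.
elim: ds z z' => [//|a [|b bs] IH] z z'; first by move=> /= -> ->.
rewrite !tup_cons2 => -[w [wb Hz]] [w' [wb' Hz']].
by rewrite -(IH _ _ wb wb') in Hz'; apply: kpair_fun Hz Hz'.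
Qed.

(** The lengths must agree because a nested tuple can also be read as a shorter one. *)
Lemma tup_inj z ds ds' : size ds = size ds' -> tup z ds -> tup z ds' -> ds = ds'.
Proof.
elim: ds z ds' => [|a [|b bs] IH] z [|a' [|b' bs']] //; first by move=> _ /= -> ->.
case=> dd; rewrite !tup_cons2 => -[w [wb Hz]] [w' [wb' Hz']].
have [aa' ww'] := kpair_inj Hz Hz'; rewrite aa'; congr cons.
by apply: (IH w) => //; [rewrite /= dd|rewrite ww'].
Qed.

Lemma tup_level z ds s : level s -> E z s -> tup z ds -> allin (subs^~ s) ds.
Proof.
move=> ls; elim: ds z => [//|a [|b bs] IH] z zs.
  by move=> /= za d [<-|//]; rewrite -za; apply: lsub.
rewrite tup_cons2 => -[w [wb /(kpair_level ls zs)[as_ ws]]] d [<-|].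
  exact: lsub.
exact: IH ws wb d.
Qed.

(** One level must serve all tuples of the given length over [s], so that a code can be separated
    from it. It is reached in one step of Endless for [n = 0] and two more for each further
    component. *)
Lemma tup_ex s n : level s -> exists t, level t /\
  forall ds, size ds = n.+1 -> allin (subs^~ s) ds -> exists z, tup z ds /\ E z t.
Proof.
move=> ls.
(* [E s t] is carried along so that the components, being subsets of [s], are members of [t] by
   potency. *)
suff [t [lt [_ Ht]]] : exists t, level t /\ E s t /\ forall ds, size ds = n.+1 ->
    allin (subs^~ s) ds -> exists z, tup z ds /\ E z t by exists t.
elim: n => [|n [t [lt [st IH]]]].
  have [t [lt st]] := endless ls; exists t; split=> //; split=> // -[|a [|//]] // _ H.
  by exists a; split=> //; apply: (lpot lt) st; apply: H; left.
have [u [lu tu]] := endless lt; have [v [lv uv]] := endless lu.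
exists v; split=> //; split; first by apply: ltr uv => //; apply: ltr tu.
move=> [|a [|b bs]] // [bn] H.
have [||w [wb wt]] := IH (b :: bs); first by rewrite /= bn.
  by move=> d db; apply: H; right.
have at_ : E a t by apply: (lpot lt) st; apply: H; left.
have [z [Hz zv]] := kpair_ex lt at_ wt lu tu lv uv.
by exists z; split=> //; exists w.
Qed.
End Tuples.

(** * Axioms of the two theories in a model *)

Lemma fo_bnd_AllFn j k p : fo_bnd j (AllFn k p) = fo_bnd (k + j) p.
Proof. by elim: k j => //= k IH j; rewrite IH addnS. Qed.

Lemma so_bnd_AllFn b k p : so_bnd b (AllFn k p) = so_bnd b p.
Proof. by elim: k => //= k ->. Qed.

Lemma fo_bnd_BigAnd k ps : fo_bnd k (BigAnd ps) = all (fo_bnd k) ps.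
Proof. by elim: ps => //= p ps ->; rewrite !andbT. Qed.

Lemma so_bnd_BigAnd b ps : so_bnd b (BigAnd ps) = all (so_bnd b) ps.
Proof. by elim: ps => //= p ps ->; rewrite !andbT. Qed.

Lemma fo_bnd_args n k : all (fun v => v < n.+1 + k) (n :: rev (iota 0 n)).
Proof.
rewrite -rev_iotaS all_rev; apply/allP => v; rewrite mem_iota => /andP[_ vn].
exact: ltn_addr.
Qed.

Lemma fo_bnd_imp k p q : fo_bnd k (FImp p q) = fo_bnd k p && fo_bnd k q.
Proof. by []. Qed.

Lemma so_bnd_imp b p q : so_bnd b (FImp p q) = so_bnd b p && so_bnd b q.
Proof. by []. Qed.

Lemma fo_bnd_Subset k x y : fo_bnd k (Subset x y) = (x < k) && (y < k).
Proof. by []. Qed.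

Lemma fo_bnd_SubRel k n F x : x < k -> fo_bnd k (SubRel n F x).
Proof.
move=> xk; rewrite fo_bnd_AllFn fo_bnd_imp; apply/andP; split; first exact: fo_bnd_args.
rewrite fo_bnd_BigAnd all_map; apply/allP => i; rewrite mem_iota => /andP[_ ik].
rewrite -[preim _ _ _]/(fo_bnd _ (Subset i (x + n.+1))) fo_bnd_Subset.
by rewrite [x + _]addnC ltn_add2l xk andbT ltn_addr.
Qed.

Lemma so_bnd_SubRel b n F x : F < b n -> so_bnd b (SubRel n F x).
Proof.
move=> Fb; rewrite so_bnd_AllFn so_bnd_imp so_bnd_BigAnd all_map.
by rewrite [so_bnd _ _]/= size_rev size_iota Fb; apply/allP.
Qed.

Lemma LTfo_sentence q : LTfo_plus q -> sentence q.
Proof. by case. Qed.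

Lemma LTb_sentence q : LTb_plus q -> sentence q.
Proof.
case=> // n; rewrite /sentence /StratB.
have -> : fo_bnd 0 (FAllS n (FEx (FAnd (Level 0) (SubRel n 0 0)))) =
  fo_bnd 1 (SubRel n 0 0) by rewrite [LHS]/= !andbT.
rewrite fo_bnd_SubRel //.
set b := (fun m => _).
have -> : so_bnd b (FAllS n (FEx (FAnd (Level 0) (SubRel n 0 0)))) =
  so_bnd (fun m => if m == n then 1 else 0) (SubRel n 0 0) by rewrite [LHS]/= !andbT.
by rewrite so_bnd_SubRel // eqxx.
Qed.

(** Every environment arises by pushing its first [k] values on the rest, so a block of [k]
    universal quantifiers can be instantiated to reach any environment. *)
Lemma push_shift (A : Type) (r : nat -> A) k :
  push (map r (rev (iota 0 k))) (fun i => r (i + k)) = r.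
Proof.
elim: k => [|k IH]; first by apply: functional_extensionality => i /=; rewrite addn0.
rewrite rev_iotaS /= -[RHS]IH; congr push.
by apply: functional_extensionality => -[|i] //=; rewrite addnS.
Qed.

Section Theories.
Variable M : model.
Implicit Types (r : nat -> dom M) (s : nat -> nat -> robj M).
Notation E := (@ein M).

Lemma sat_Extensionality r s : sat r s Extensionality <->
  forall x y, (forall z, E z x <-> E z y) -> x = y.
Proof.
have K x y : sat (scons y (scons x r)) s (FAllF (FIff (FIn 0 2) (FIn 0 1))) <->
    forall z, E z x <-> E z y by rewrite sat_allF; setoid_rewrite sat_iff.
by split=> H x y /K; apply: H.
Qed.

Lemma sat_Stratification r s : sat r s Stratification <->
  forall x, exists t, level E t /\ subs E x t.
Proof.
rewrite sat_allF; setoid_rewrite sat_ex; setoid_rewrite sat_and.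
by setoid_rewrite sat_Level; setoid_rewrite sat_Subset.
Qed.

Lemma sat_Endless r s : sat r s Endless <->
  forall x, level E x -> exists t, level E t /\ E x t.
Proof.
rewrite sat_allF; setoid_rewrite sat_imp; setoid_rewrite sat_Level; setoid_rewrite sat_ex.
by setoid_rewrite sat_and; setoid_rewrite sat_Level.
Qed.

Lemma sat_SepFOInst r s phi : isFO phi -> sat r s (SepFOInst phi) <->
  forall a, exists b, forall x, E x b <-> fsat E (scons x (scons a r)) phi /\ E x a.
Proof.
move=> phiFO; rewrite sat_allF; setoid_rewrite sat_ex; setoid_rewrite sat_allF.
setoid_rewrite sat_iff; setoid_rewrite sat_and; setoid_rewrite sat_ren_fo.
suff H a b x : sat (scons x (scons b (scons a r)) \o
      (fun i => match i with 0 => 0 | 1 => 2 | j => j.+1 end)) s phi <->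
    fsat E (scons x (scons a r)) phi by setoid_rewrite H.
rewrite sat_FO //; set e := _ \o _; set e' := scons x _.
suff -> : e = e' by [].
by apply: functional_extensionality => -[|[|i]].
Qed.

Lemma sat_AllFn_closed r s k p : sentence (AllFn k p) -> sat r s (AllFn k p) <->
  forall r' s', sat r' s' p.
Proof.
move=> cl; split=> [H r' s'|H]; last by apply/sat_AllFn => ds _; apply: H.
have := @sat_sentence M r (fun i => r' (i + k)) s s' _ cl H.
move/sat_AllFn => /(_ (map r' (rev (iota 0 k)))).
by rewrite push_shift; apply; rewrite size_map size_rev size_iota.
Qed.

Lemma isFO_AllFn k p : isFO (AllFn k p) = isFO p.
Proof. by elim: k => //= k ->. Qed.

Lemma LTfo_isLT r s : (forall q, LTfo_plus q -> sat r s q) -> isLT E.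
Proof.
move=> H; split.
- exact: (iffLR (sat_Extensionality r s) (H _ LTfo_ext)).
- exact: (iffLR (sat_Stratification r s) (H _ LTfo_strat)).
- exact: (iffLR (sat_Endless r s) (H _ LTfo_endless)).
- move=> P [psi [r' [psiFO HP]]].
  (* Index 1 of a Separation instance is the set [a], so the parameters move up by one. *)
  pose f i := if i is j.+1 then j.+2 else 0.
  pose phi := ren f idS psi.
  have phiFO : isFO phi by rewrite isFO_ren.
  (* Enough outer quantifiers to close the instance. *)
  pose k := mxv (SepFOInst phi).
  have sepFO : isFO (SepFOInst phi) by rewrite /= ren_foE isFO_ren phiFO.
  have cl : sentence (AllFn k (SepFOInst phi)).
    by rewrite /sentence fo_bnd_AllFn addn0 fo_bnd_mxv so_bnd_FO // isFO_AllFn.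
  have := H _ (LTfo_sep phiFO cl); rewrite sat_AllFn_closed // => /(_ r' s).
  rewrite sat_SepFOInst // => Hs a; have [b Hb] := Hs a; exists b => x.
  rewrite Hb HP /fsat sat_ren; set e := _ \o f; set e' := scons x r'.
  by have -> : e = e' by apply: functional_extensionality => -[].
Qed.

Lemma isLT_LTfo r s q : isLT E -> LTfo_plus q -> sat r s q.
Proof.
move=> LT; case=> [|||k phi phiFO cl].
- exact/sat_Extensionality/lt_ext.
- exact/sat_Stratification/lt_strat.
- exact/sat_Endless/lt_endless.
- apply/sat_AllFn_closed => // r' s'; apply/sat_SepFOInst => // a.
  have dP : dfn E (fun x => fsat E (scons x (scons a r')) phi) by exists phi, (scons a r').
  exact: lt_sep LT _ dP a.
Qed.

Definition bounded_comp n x (P : seq (dom M) -> Prop) := exists u, rsort n u /\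
  (forall ds, size ds = n.+1 -> rapp u ds -> allin (fun d => subs E d x) ds) /\
  forall ds, size ds = n.+1 -> allin (fun d => subs E d x) ds -> (rapp u ds <-> P ds).

Lemma sat_CompBInst r s n phi : sat r s (CompBInst n phi) <->
  forall x, level E x -> bounded_comp n x (fun ds => sat (push ds (scons x r)) s phi).
Proof.
rewrite sat_allF; setoid_rewrite sat_imp; setoid_rewrite sat_Level.
setoid_rewrite sat_exS; setoid_rewrite sat_and; setoid_rewrite sat_SubRel.
setoid_rewrite sat_AllFn; setoid_rewrite sat_imp; setoid_rewrite sat_iff.
setoid_rewrite sat_ren_soS; rewrite /bounded_comp.
have E1 u : sconsS n u s n 0 = u by rewrite /sconsS eqxx.
have E2 x u ds : size ds = n.+1 -> sat (push ds (scons x r)) (sconsS n u s)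
    (FApp 0 n (rev (iota 0 n))) <-> rapp u ds.
  by move=> dn; rewrite sat_app push_args // size_rev size_iota E1.
have E3 x u ds : size ds = n.+1 -> sat (push ds (scons x r)) (sconsS n u s)
    (BigAnd [seq Subset i n.+1 | i <- iota 0 n.+1]) <->
    allin (fun d => subs E d x) ds.
  by move=> dn; rewrite sat_allsub // -dn -[size ds]add0n pushD.
split=> H x lx; have [u [nu [Hu1 Hu2]]] := H x lx; exists u; split=> //; split.
- by move=> ds dn du; apply: Hu1 => //; rewrite E1.
- by move=> ds dn ds_; rewrite -Hu2 ?E2 ?E3.
- by move=> ds dn; rewrite E1 => du; apply: Hu1.
- by move=> ds dn /E3 H'; rewrite E2 // Hu2 //; apply: H'.
Qed.

Lemma sat_SepSO r s : sat r s SepSO <-> forall u, rsort 0 u ->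
  forall a, exists b, forall x, E x b <-> rapp u [:: x] /\ E x a.
Proof.
rewrite sat_allS; setoid_rewrite sat_allF; setoid_rewrite sat_ex.
setoid_rewrite sat_allF; setoid_rewrite sat_iff; setoid_rewrite sat_and.
by setoid_rewrite sat_app.
Qed.

Lemma sat_StratB r s n : sat r s (StratB n) <-> forall u, rsort n u ->
  exists x, level E x /\ forall ds, size ds = n.+1 -> rapp u ds ->
    allin (fun d => subs E d x) ds.
Proof.
rewrite sat_allS; setoid_rewrite sat_ex; setoid_rewrite sat_and.
setoid_rewrite sat_Level; setoid_rewrite sat_SubRel.
suff H u : sconsS n u s n 0 = u by split=> H' u nu; have := H' u nu; rewrite H.
by rewrite /sconsS eqxx.
Qed.
End Theories.

(** * Models of bounded level theory *)

Lemma close_nseq k p : close (nseq k None) p = AllFn k p.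
Proof. by elim: k => //= k ->. Qed.

Lemma isFO_TupEqK k z x xs : isFO (TupEqK k z x xs).
Proof. by elim: xs k z x => //= y ys IH k z x; rewrite IH. Qed.

Lemma isFO_ExFn n p : isFO (ExFn n p) = isFO p.
Proof. by elim: n => //= n ->; rewrite !andbT. Qed.

Lemma so_bnd_ExFn b n p : so_bnd b (ExFn n p) = so_bnd b p.
Proof. by elim: n => //= n ->; rewrite !andbT. Qed.

Lemma so_bnd_FAnd b p q : so_bnd b (FAnd p q) = so_bnd b p && so_bnd b q.
Proof. by rewrite /= !andbT. Qed.

Lemma so_bnd_CompBInst b n phi : so_bnd b phi -> so_bnd b (CompBInst n phi).
Proof.
move=> pb; set b' := fun m => if m == n then (b m).+1 else b m.
have b'n : 0 < b' n by rewrite /b' eqxx.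
have phib : so_bnd b' (ren_so n S phi).
  rewrite ren_soE; apply: so_bnd_ren pb => m i; rewrite /single /b'.
  by case: eqP.
have -> : so_bnd b (CompBInst n phi) = so_bnd b' (FAnd (SubRel n 0 0)
    (AllFn n.+1 (FImp (BigAnd [seq Subset i n.+1 | i <- iota 0 n.+1])
       (FIff (FApp 0 n (rev (iota 0 n))) (ren_so n S phi))))).
  by rewrite /= !andbT.
rewrite so_bnd_FAnd so_bnd_SubRel // so_bnd_AllFn so_bnd_imp so_bnd_BigAnd all_map.
rewrite so_bnd_FAnd !so_bnd_imp phib [so_bnd _ (FApp _ _ _)]/= size_rev size_iota b'n.
by rewrite !andbT; apply/allP.
Qed.

Section BoundedModel.
Variables (M : model) (r0 : nat -> dom M) (s0 : nat -> nat -> robj M).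
Hypothesis s0_valid : valid s0.
Hypothesis LTb_sat : forall q, LTb_plus q -> sat r0 s0 q.
Notation E := (@ein M).

(** Comprehension with one relation parameter, variable 0 of arity code [m], and any first-order
    parameters. [codes_total] passes the relation to be coded in this way. *)
Lemma bounded_comp_sat n m phi r s x :
  so_bnd (fun k => if k == m then 1 else 0) phi -> rsort m (s m 0) -> level E x ->
  bounded_comp n x (fun ds => sat (push ds (scons x r)) s phi).
Proof.
move=> phib sm lx; pose k := mxv (CompBInst n phi).
have cl : sentence (close (Some m :: nseq k None) (CompBInst n phi)).
  rewrite /sentence [close _ _]/= close_nseq; apply/andP; split.
    by rewrite /= fo_bnd_AllFn addn0 fo_bnd_mxv.
  by rewrite /= so_bnd_AllFn so_bnd_CompBInst.
(* [s] with the relation parameter removed, so that instantiating the outer second-order quantifier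
   puts it back. *)
pose s' j i := if j == m then s j i.+1 else s j i.
have s'E : sconsS m (s m 0) s' = s.
  apply: functional_extensionality => j; apply: functional_extensionality => i.
  by rewrite /sconsS /s'; case: eqP => // ->; case: i.
have := @sat_sentence M r0 (fun i => r (i + k)) s0 s' _ cl (LTb_sat (LTb_comp cl)).
rewrite [close _ _]/= close_nseq sat_allS => /(_ _ sm); rewrite s'E.
move/sat_AllFn => /(_ (map r (rev (iota 0 k)))).
rewrite push_shift size_map size_rev size_iota => /(_ erefl).
by rewrite sat_CompBInst; apply.
Qed.

Lemma bounded_comp_FO n psi r x : isFO psi -> level E x ->
  bounded_comp n x (fun ds => fsat E (push ds (scons x r)) psi).
Proof.
move=> psiFO lx.
(* A first-order formula has no relation parameter; an arbitrary relation of [s0] fills the slot. *)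
have [u [nu [Hu1 Hu2]]] := bounded_comp_sat n r (so_bnd_FO _ psiFO) (s0_valid 0 0) lx.
by exists u; split=> //; split=> // ds dn ds_; rewrite Hu2 // sat_FO.
Qed.

Lemma sep_SO u a : rsort 0 u -> exists b, forall x, E x b <-> rapp u [:: x] /\ E x a.
Proof. by move=> u0; apply: (iffLR (sat_SepSO r0 s0) (LTb_sat LTb_sep) _ u0). Qed.

Lemma allin1 (A : Type) (P : A -> Prop) x : allin P [:: x] <-> P x.
Proof. by split=> [H|H y [<-|//] //]; apply: H; left. Qed.

(** Comprehension at [s] realises [P] as a unary relation on the subsets of [s]; second-order
    Separation then carves it out of [a]. *)
Lemma LTb_bounded_sep P : dfn E P -> forall s a, level E s ->
  exists b, forall x, E x b <-> P x /\ subs E x s /\ E x a.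
Proof.
move=> [psi [r [psiFO HP]]] s a ls.
pose f i := if i is j.+1 then j.+2 else 0.
have phiFO : isFO (ren f idS psi) by rewrite isFO_ren.
have [u [u0 [Hu1 Hu2]]] := bounded_comp_FO 0 r phiFO ls.
have [b Hb] := sep_SO a u0; exists b => x; rewrite Hb.
have xP : P x <-> fsat E (push [:: x] (scons s r)) (ren f idS psi).
  rewrite HP /fsat sat_ren; set e := scons x r; set e' := _ \o _.
  by have -> : e = e' by apply: functional_extensionality => -[].
split=> [[ux xa]|[Px [xs xa]]].
  have /allin1 xs := Hu1 [:: x] erefl ux.
  by split; [apply/xP/Hu2 => //; apply/allin1|].
by split=> //; apply/Hu2/xP => //; apply/allin1.
Qed.

Lemma LTb_isLT : isLT E.
Proof.
have ext := iffLR (sat_Extensionality r0 s0) (LTb_sat LTb_ext).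
have strat := iffLR (sat_Stratification r0 s0) (LTb_sat LTb_strat).
split=> //; first exact: (iffLR (sat_Endless r0 s0) (LTb_sat LTb_endless)).
move=> P dP a; have [s [ls as_]] := strat a.
have [b Hb] := LTb_bounded_sep dP a ls; exists b => x; rewrite Hb.
split=> [[? []]//|[Px xa]]; split=> //; split=> //.
(* Transitivity of levels removes the bound: members of [a] are members, hence subsets, of [s]. *)
by apply: (level_sub strat LTb_bounded_sep) => //; apply: as_.
Qed.

(** [StratB] bounds [u] by a level [s], and the tuples over [s] lie in one level [t]. Being a tuple
    that satisfies [u] is made a unary relation by comprehension at [t], then separated from [t]. *)
Lemma codes_total n u : rsort n u -> exists y, tupset E n y /\ codes n u y.
Proof.
move=> nu; have LT := LTb_isLT.
have [s [ls us]] := iffLR (sat_StratB r0 s0 n) (LTb_sat (LTb_stratb n)) u nu.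
have [t [lt Ht]] := tup_ex LT n ls.
pose phi := ExFn n.+1 (FAnd (TupEq (0 + n.+1) n (rev (iota 0 n)))
                            (FApp 0 n (rev (iota 0 n)))).
pose s1 := sconsS n u s0.
have s1u : s1 n 0 = u by rewrite /s1 /sconsS eqxx.
have phib : so_bnd (fun k => if k == n then 1 else 0) phi.
  rewrite so_bnd_ExFn so_bnd_FAnd so_bnd_FO ?isFO_TupEqK //=.
  by rewrite size_rev size_iota eqxx.
have [|G [G0 [HG1 HG2]]] := bounded_comp_sat 0 r0 phib (s := s1) _ lt.
  by rewrite s1u.
have phiE z : sat (push [:: z] (scons t r0)) s1 phi <->
    exists ds, size ds = n.+1 /\ tup E z ds /\ rapp u ds.
  rewrite sat_ExFn.
  suff K ds : size ds = n.+1 -> sat (push ds (push [:: z] (scons t r0))) s1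
      (FAnd (TupEq (0 + n.+1) n (rev (iota 0 n))) (FApp 0 n (rev (iota 0 n)))) <->
      tup E z ds /\ rapp u ds.
    by split=> -[ds [dn /(K _ dn)]]; exists ds.
  move=> dn; rewrite sat_and sat_TupEq sat_app push_args // size_rev size_iota s1u.
  by rewrite -dn pushD.
have [y Hy] := sep_SO t G0.
have {}Hy z : E z y <-> E z t /\ exists ds, size ds = n.+1 /\ tup E z ds /\ rapp u ds.
  rewrite Hy -phiE; split=> [[Gz zt]|[zt H]]; split=> //.
    by apply/HG2 => //; apply: HG1.
  apply/HG2 => //; apply/allin1.
  by apply: (level_sub (lt_strat LT) (lt_bounded_sep LT)).
exists y; split=> [z /Hy[_ [ds [dn [zds _]]]]|ds dn]; first by exists ds.
split=> [uds|[z [zds /Hy[_ [ds' [dn' [zds' uds']]]]]]].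
  have [z [zds zt]] := Ht ds dn (us ds dn uds).
  by exists z; split=> //; apply/Hy; split=> //; exists ds.
by rewrite (tup_inj LT (ds := ds) (ds' := ds') _ zds zds') ?dn.
Qed.

Lemma codes_onto n y : tupset E n y -> exists u, rsort n u /\ codes n u y.
Proof.
move=> ny; have LT := LTb_isLT.
have [s [ls ys]] := lt_strat LT y.
(* Below the arguments, index 0 is the level and index 1 the parameter [y]. *)
have phiFO : isFO (in_tup n 1) by rewrite /= isFO_TupEqK.
have [u [nu [Hu1 Hu2]]] := bounded_comp_FO n (fun=> y) phiFO ls.
exists u; split=> // ds dn.
have K : fsat E (push ds (scons s (fun=> y))) (in_tup n 1) <->
  exists z, tup E z ds /\ E z y by apply: sat_in_tup.
split=> [uds|[z [zds zy]]].
  by apply/K/Hu2 => //; apply: Hu1.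
apply/Hu2/K => //; last by exists z.
by apply: (tup_level LT) zds => //; apply: ys.
Qed.

Lemma codes_unique n u y y' : tupset E n y -> codes n u y ->
  tupset E n y' -> codes n u y' -> y' = y.
Proof.
have LT := LTb_isLT.
have K y1 y2 : tupset E n y1 -> codes n u y1 -> codes n u y2 -> subs E y1 y2.
  move=> ny1 c1 c2 z zy; have [ds [dn zds]] := ny1 z zy.
  have /(c2 ds dn)[z' [zds' zy']] : rapp u ds by apply/c1 => //; exists z.
  by rewrite (tup_fun LT zds zds').
by move=> ny cy ny' cy'; apply: (lt_ext LT) => z; split; apply: K.
Qed.

Lemma sat_IsoTotal n : sat r0 s0 (IsoTotal n).
Proof.
rewrite sat_allS => u nu; rewrite sat_ex; setoid_rewrite sat_and.
setoid_rewrite sat_and; setoid_rewrite sat_TupSet; setoid_rewrite sat_Codes.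
have [y [ny cy]] := codes_total nu.
have uE : sconsS n u s0 n 0 = u by rewrite /sconsS eqxx.
exists y; split=> //; split; first by rewrite uE.
rewrite sat_allF => y'; rewrite sat_imp sat_and sat_TupSet sat_Codes uE => -[ny' cy'].
exact: codes_unique ny cy ny' cy'.
Qed.

Lemma sat_IsoOnto n : sat r0 s0 (IsoOnto n).
Proof.
rewrite sat_allF => y; rewrite sat_imp sat_TupSet sat_exS => /codes_onto[u [nu cu]].
by exists u; split=> //; rewrite sat_Codes /sconsS eqxx.
Qed.
End BoundedModel.

(** * The translation *)

Section Translation.
Variable M : model.
Implicit Types (r t : nat -> dom M) (s : nat -> nat -> robj M).
Notation E := (@ein M).

(** Beyond the binders listed in [c], the positions of different variables may collide, so agreement
    is asked only below the bounds. For a sentence these are 0 and nothing is asked. *)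
Definition interprets (c : seq (option nat)) (k : nat) (b : nat -> nat) r s t :=
  (forall i, i < k -> t (posF c i) = r i) /\
  (forall n i, i < b n -> codes n (s n i) (t (posS c n i))).

Lemma interprets_F c k b r s t d : interprets c k b r s t ->
  interprets (None :: c) k.+1 b (scons d r) s (scons d t).
Proof. by move=> [HF HS]; split=> // -[|i] //=; apply: HF. Qed.

Lemma interprets_S c k b r s t n u y : interprets c k b r s t -> codes n u y ->
  interprets (Some n :: c) k (fun m => if m == n then (b m).+1 else b m)
    r (sconsS n u s) (scons y t).
Proof.
move=> [HF HS] uy; split=> // m i; rewrite /sconsS /= [n == m]eq_sym.
case: eqP => [->|_]; last exact: HS.
by case: i => //= i; apply: HS.
Qed.

Lemma interprets_push c k b r s t ds : interprets c k b r s t ->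
  interprets (nseq (size ds) None ++ c) (size ds + k) b (push ds r) s (push ds t).
Proof.
elim: ds c k r t => [//|d ds IH] c k r t /(interprets_F d)/IH.
have -> : nseq (size ds) None ++ None :: c = nseq (size (d :: ds)) None ++ c.
  by rewrite /=; elim: (size ds) => //= j ->.
by rewrite addnS.
Qed.

Hypothesis total : forall n u, rsort n u -> exists y, tupset E n y /\ codes n u y.
Hypothesis onto : forall n y, tupset E n y -> exists u, rsort n u /\ codes n u y.

(** At a second-order quantifier, [onto] turns a set of tuples into a relation and [total] turns a
    relation into its code. Both kinds of model supply these two facts. *)
Lemma sat_dag c k b r s t p : interprets c k b r s t -> fo_bnd k p -> so_bnd b p ->
  sat r s p <-> fsat E t (dag c p).
Proof.
elim: p c k b r s t => [|x y|x y|Y x xs|p IHp q IHq|p IH|n p IH] c k b r s t I.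
- by [].
- by move: I => [HF _] /= /andP[xk yk] _; rewrite /fsat /= !HF.
- by move: I => [HF _] /= /andP[xk yk] _; rewrite /fsat /= !HF.
- move: I => [HF HS] xk Yb; rewrite sat_app (HS _ _ Yb) ?size_map //.
  have -> : map r (x :: xs) = map (fun v => t (posF c v)) (x :: xs).
    by apply/eq_in_map => v /(allP xk)/HF.
  rewrite /fsat sat_ex; setoid_rewrite sat_and; setoid_rewrite sat_TupEq.
  suff K z : [seq scons z t i | i <- (posF c x).+1 :: [seq (posF c v).+1 | v <- xs]] =
      [seq t (posF c v) | v <- x :: xs].
    by setoid_rewrite K.
  by rewrite /= -map_comp.
- move=> /andP[pk qk] /andP[pb qb].
  by rewrite sat_imp /fsat sat_imp (IHp c k b r s t) // (IHq c k b r s t).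
- move=> pk pb; rewrite sat_allF /fsat sat_allF.
  have K d := IH _ _ _ _ _ _ (interprets_F d I) pk pb.
  by split=> H d; apply/K/H.
- move=> pk pb; rewrite sat_allS /fsat sat_allF.
  have K u y cy := IH _ _ _ _ _ _ (interprets_S (n := n) (u := u) (y := y) I cy) pk pb.
  split=> [H y|H u nu].
    rewrite sat_imp => /(iffLR (@sat_TupSet (fo_model E) _ _ n 0)) ny.
    by have [u [nu cu]] := onto ny; apply/(K u) => //; apply: H.
  have [y [ny cu]] := total nu; apply/(K u y cu).
  by move: (H y); rewrite sat_imp; apply; apply/(@sat_TupSet (fo_model E) _ _ n 0).
Qed.

Lemma sat_dagger r s t p : sentence p -> sat r s p <-> fsat E t (dagger p).
Proof. by move=> /andP[pk pb]; apply: sat_dag pk pb. Qed.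
End Translation.

Lemma isFO_dag c p : isFO (dag c p).
Proof.
elim: p c => //= [Y x xs|p IHp q IHq|n p IH] c; rewrite ?isFO_TupEqK ?IHp ?IHq ?IH //.
by rewrite isFO_ExFn isFO_TupEqK.
Qed.

Lemma dag_FO k p : isFO p -> dag (nseq k None) p = p.
Proof.
have posE i : posF (nseq k None) i = i by elim: k i => //= k IH [|i] //=; rewrite IH.
elim: p k posE => //= [x y|x y|p IHp q IHq|p IH] k posE; rewrite ?posE //.
  by move=> /andP[pFO qFO]; rewrite IHp ?IHq.
move=> pFO; rewrite -[None :: _]/(nseq k.+1 None) IH // => -[|i] //=.
by rewrite posE.
Qed.

(** * The model whose relations are sets of tuples *)

Definition tup_model (D : Type) (E : D -> D -> Prop) : model := {|
  dom := D; ein := E; robj := D;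
  rsort := tupset E; rapp := fun y ds => exists z, tup E z ds /\ E z y |}.

Lemma fo_bnd_FAnd k p q : fo_bnd k (FAnd p q) = fo_bnd k p && fo_bnd k q.
Proof. by rewrite /= !andbT. Qed.

Lemma fo_bnd_FIff k p q : fo_bnd k (FIff p q) = fo_bnd k p && fo_bnd k q.
Proof. by rewrite /= !andbT; case: (fo_bnd k p); case: (fo_bnd k q). Qed.

Lemma so_bnd_FIff b p q : so_bnd b (FIff p q) = so_bnd b p && so_bnd b q.
Proof. by rewrite /= !andbT; case: (so_bnd b p); case: (so_bnd b q). Qed.

Lemma CompBInst_bnd k b n phi : fo_bnd k (CompBInst n phi) -> so_bnd b (CompBInst n phi) ->
  fo_bnd (n.+1 + k.+1) (ren_so n S phi) /\
  so_bnd (fun m => if m == n then (b m).+1 else b m) (ren_so n S phi).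
Proof.
pose B := AllFn n.+1 (FImp (BigAnd [seq Subset i n.+1 | i <- iota 0 n.+1])
                       (FIff (FApp 0 n (rev (iota 0 n))) (ren_so n S phi))).
have -> : fo_bnd k (CompBInst n phi) = fo_bnd k.+1 (FAnd (SubRel n 0 0) B).
  by rewrite /= !andbT.
have -> : so_bnd b (CompBInst n phi) = so_bnd (fun m => if m == n then (b m).+1 else b m)
    (FAnd (SubRel n 0 0) B) by rewrite /= !andbT.
rewrite fo_bnd_FAnd so_bnd_FAnd /B fo_bnd_AllFn so_bnd_AllFn fo_bnd_imp so_bnd_imp.
by rewrite fo_bnd_FIff so_bnd_FIff => /and4P[_ _ _ ->] /and4P[_ _ _ ->].
Qed.

Section TupleModel.
Variables (D : Type) (E : D -> D -> Prop).
Hypothesis LT : isLT E.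
Notation M := (tup_model E).

Lemma isFO_BigAnd ps : isFO (BigAnd ps) = all isFO ps.
Proof. by elim: ps => //= p ps ->; rewrite !andbT. Qed.

Lemma tup_bounded_comp n psi r x : isFO psi -> level E x ->
  bounded_comp (M := M) n x (fun ds => fsat E (push ds r) psi).
Proof.
move=> psiFO lx; have [t [lt Ht]] := tup_ex LT n lx.
pose P z := exists ds, size ds = n.+1 /\
  (tup E z ds /\ allin (fun d => subs E d x) ds /\ fsat E (push ds r) psi).
have dP : dfn E P.
  (* The components keep their indices; the parameters skip [z] and [x], which occupy the next two
     places. *)
  pose f i := if i < n.+1 then i else i.+2.
  pose chi := FAnd (TupEq (0 + n.+1) n (rev (iota 0 n)))
    (FAnd (BigAnd [seq Subset i (1 + n.+1) | i <- iota 0 n.+1]) (ren f idS psi)).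
  exists (ExFn n.+1 chi), (scons x r); split=> [|z].
    have FOand p q : isFO (FAnd p q) = isFO p && isFO q by rewrite /= !andbT.
    rewrite isFO_ExFn !FOand isFO_TupEqK isFO_BigAnd all_map isFO_ren psiFO andbT.
    exact/allP.
  rewrite /fsat sat_ExFn.
  suff K ds : size ds = n.+1 ->
      sat (M := fo_model E) (push ds (scons z (scons x r))) (fun _ _ => tt) chi <->
      (tup E z ds /\ allin (fun d => subs E d x) ds /\ fsat E (push ds r) psi).
    by split=> -[ds [dn /(K _ dn)]]; exists ds.
  move=> dn; rewrite sat_and sat_and sat_TupEq push_args // sat_allsub //.
  rewrite sat_ren -!dn !pushD.
  have -> : push ds (scons z (scons x r)) \o f = push ds r; last by [].
  apply: functional_extensionality => i; rewrite /= /f -dn.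
  case: ltnP => [/push_lt|/subnK <-]; first by apply.
  by rewrite -!addSn !pushD.
have [y Hy] := lt_sep LT dP t; exists y; split.
  by move=> z /Hy[[ds [dn [zds _]]] _]; exists ds.
have Hds ds : size ds = n.+1 -> rapp (m := M) y ds ->
    allin (fun d => subs E d x) ds /\ fsat E (push ds r) psi.
  move=> dn [z [zds /Hy[[ds' [dn' [zds' [H1 H2]]]] _]]].
  by rewrite (tup_inj LT (ds := ds) (ds' := ds') _ zds zds') ?dn.
split=> ds dn; first by move/(Hds _ dn) => [].
move=> dx; split=> [/(Hds _ dn)[]//|Hpsi].
have [z [zds zt]] := Ht ds dn dx.
by exists z; split=> //; apply/Hy; split=> //; exists ds.
Qed.

(** In this model a relation is its own code. *)
Lemma tup_total n (u : robj M) : rsort n u -> exists y, tupset E n y /\ codes (M := M) n u y.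
Proof. by exists u. Qed.

Lemma tup_onto n y : tupset E n y -> exists u : robj M, rsort n u /\ codes (M := M) n u y.
Proof. by exists y. Qed.

(** Translating [phi] turns its second-order parameters into set parameters, after which first-order
    Separation applies. *)
Lemma tup_comp c k b (r : nat -> dom M) s t n phi : valid s ->
  interprets (M := M) c k b r s t ->
  fo_bnd k (CompBInst n phi) -> so_bnd b (CompBInst n phi) ->
  sat (M := M) r s (CompBInst n phi).
Proof.
move=> vs I Ck Cb; have [pk pb] := CompBInst_bnd Ck Cb.
apply/sat_CompBInst => x lx.
(* The bounds are known for the lifted formula, so the translation is made under the binder of the
   relation being defined. Any relation may fill that slot, since [phi] is lifted past it. *)
pose y := s n 0.
pose c' := nseq n.+1 None ++ [:: Some n, None & c].
pose psi := dag c' (ren_so n S phi).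
have K ds : size ds = n.+1 -> sat (M := M) (push ds (scons x r)) s phi <->
    fsat E (push ds (scons y (scons x t))) psi.
  move=> dn; rewrite -(sat_ren_soS _ _ n y).
  have cy : codes (M := M) n y y by [].
  have := interprets_push ds (interprets_S (interprets_F x I) cy).
  by rewrite dn => /(sat_dag tup_total tup_onto); apply.
have [u [nu [Hu1 Hu2]]] :=
  tup_bounded_comp n (scons y (scons x t)) (isFO_dag c' (ren_so n S phi)) lx.
by exists u; split=> //; split=> // ds dn ds_; rewrite K //; apply: Hu2.
Qed.

Lemma tup_close c k b (r : nat -> dom M) s t pre n phi : valid s ->
  interprets (M := M) c k b r s t ->
  fo_bnd k (close pre (CompBInst n phi)) -> so_bnd b (close pre (CompBInst n phi)) ->
  sat (M := M) r s (close pre (CompBInst n phi)).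
Proof.
elim: pre c k b r s t => [|[m|] pre IH] c k b r s t vs I pk pb.
- exact: tup_comp I pk pb.
- move=> u mu; apply: IH pk pb; first exact: valid_sconsS.
  by apply: interprets_S I _; instantiate (1 := u).
- by move=> d; apply: IH (interprets_F d I) pk pb.
Qed.

Lemma tup_LTb (r : nat -> dom M) s q : valid s -> LTb_plus q -> sat (M := M) r s q.
Proof.
move=> vs; case=> [|||n|n pre phi /andP[pk pb]|].
- exact/sat_Extensionality/(lt_ext LT).
- apply/sat_SepSO => u _ a.
  have dP : dfn E (fun x => E x u) by exists (FIn 0 1), (fun=> u).
  have [b Hb] := lt_sep LT dP a; exists b => x.
  (* A 1-tuple is its own component, so a unary relation applies to exactly its members. *)
  split=> [/Hb[xu xa]|[[z [/= -> zu]] xa]]; last exact/Hb.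
  by split=> //; exists x.
- exact/sat_Stratification/(lt_strat LT).
- apply/sat_StratB => u nu; have [x [lx ux]] := lt_strat LT u.
  exists x; split=> // ds dn [z [zds zu]].
  by apply: (tup_level LT) zds => //; apply: ux.
- by apply: (tup_close (c := [::]) (t := r)) pk pb.
- exact/sat_Endless/(lt_endless LT).
Qed.

(** The empty set is a set of tuples of every length, so it can interpret all relation variables. *)
Lemma tup_valid (x : D) : exists s : nat -> nat -> robj M, valid s.
Proof.
have dP : dfn E (fun=> False) by exists FBot, (fun=> x).
have [e He] := lt_sep LT dP x; exists (fun _ _ => e) => n i z.
by rewrite He => -[].
Qed.
End TupleModel.

Theorem theorem23 :
  (forall phi : form, isFO phi -> sentence phi ->
     (proves LTfo_plus phi <-> proves LTb_plus phi)) /\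
  (forall phi : form, sentence phi ->
     (proves LTb_plus phi <-> proves LTfo_plus (dagger phi))) /\
  (forall n : nat, proves LTb_plus (IsoTotal n) /\ proves LTb_plus (IsoOnto n)).
Proof.
have part2 phi : sentence phi -> (proves LTb_plus phi <-> proves LTfo_plus (dagger phi)).
  move=> phi_cl; split=> D; apply: completeness.
  - exact: LTfo_sentence.
  (* The relations of the given model are replaced by its sets of tuples; the translated sentence,
     being first-order, is unaffected. *)
  - move=> M r s vs /LTfo_isLT LT; have [s' vs'] := tup_valid LT (r 0).
    have H := proves_sat D vs' (fun q => @tup_LTb _ _ LT r s' q vs').
    apply/sat_FO; first exact: isFO_dag.
    exact: iffLR (sat_dagger (@tup_total _ _) (@tup_onto _ _) r s' r phi_cl) H.
  - exact: LTb_sentence.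
  - move=> M r s vs H; have LT := LTb_isLT vs H.
    have := proves_sat D vs (fun q => @isLT_LTfo M r s q LT).
    rewrite sat_FO ?isFO_dag // => Hd.
    exact: iffRL (sat_dagger (codes_total vs H) (codes_onto vs H) r s r phi_cl) Hd.
split=> [phi phiFO phi_cl|]; last split=> // n.
  by rewrite part2 // /dagger (dag_FO 0).
split; apply: (completeness LTb_sentence) => M r s vs H.
  exact: sat_IsoTotal.
exact: sat_IsoOnto.
Qed.
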